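(* Let $G$ be a finite connected graph with Hermitian edge weights and real potential, and let $\mathcal T$ be its universal cover, with density of states $\mu$. For any $\lambda\in\mathbb R$ and $X\in\mathcal A_\lambda(G)$, (i) $\lambda\in\operatorname{Spec}A_G$, with multiplicity at least $\mathsf{cc}(X)-|\partial X|$; (ii) $\lambda\in\operatorname{Spec}_pA_{\mathcal T}$, and $|V(G)|\cdot\mu\{\lambda\}\ge\mathsf{cc}(X)-|\partial X|$.
   Context: Graphs. A graph $G=(V,E,a,b)$ (self-loops and multi-edges allowed) has a vertex set $V$, a set $E$ of directed edges with a fixed-point-free direction-reversing involution $e\mapsto\check e$, source and terminal maps $\sigma,\tau:E\to V$ with $\sigma(e)=\tau(\check e)$, edge weights $a:E\to\mathbb C$ and potential $b:V\to\mathbb C$. For a vertex $u$, $\tau(u)$ also denotes the set of directed edges with terminal $u$. Weights and potential are Hermitian: $\overline{a_e}=a_{\check e}$ for all $e$, and $b$ is real. A non-backtracking walk is a sequence of edges $e_1,\dots,e_\ell$ with $\tau(e_s)=\sigma(e_{s+1})$ and $e_s\ne\check e_{s+1}$ for $1\le s\le \ell-1$. A graph is acyclic if it has no closed non-backtracking walk (so an acyclic graph has no self-loops or multi-edges and its connected components are trees). Universal cover. For $G$ connected, the universal cover $\mathcal T=(\mathcal V,\mathcal E,\mathscr a,\mathscr b)$ is the (unique up to isomorphism) tree covering every cover of $G$; concretely, its vertices are the non-backtracking walks in $G$ starting at a fixed root (including the empty walk), two walks being joined by an edge (in both directions) when one extends the other by one edge. The covering map is $\Xi:\mathcal T\to G$,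 and $\mathscr a_{\tilde e}=a_{\Xi(\tilde e)}$, $\mathscr b_{\tilde v}=b_{\Xi(\tilde v)}$. Jacobi operators. $A_G$ acts on $\ell^2(V)$ by $(A_G\eta)(u)=b_u\eta(u)+\sum_{e\in\tau(u)}a_e\,\eta(\sigma(e))$; $A_{\mathcal T}$ is the bounded self-adjoint operator on $\ell^2(\mathcal V)$ given by the same formula on $\mathcal T$. The induced Jacobi operator of a subgraph is the Jacobi operator of that subgraph with the inherited weights and potential. The point spectrum is $\operatorname{Spec}_pA_{\mathcal T}=\{\lambda\in\mathbb R:\operatorname{Ker}(\lambda-A_{\mathcal T})\ne\{0\}\}$, with kernels in $\ell^2(\mathcal V)$. For $u\in V$, $\mu_u$ is the spectral measure with $\langle\delta_{\tilde u},f(A_{\mathcal T})\delta_{\tilde u}\rangle=\int f\,d\mu_u$ for every $\tilde u\in\Xi^{-1}(u)$ and bounded measurable $f$; the density of states is $\mu=\frac1{|V|}\sum_{u\in V}\mu_u$. For $X\subset V$, the subgraph induced by $X$ contains all edges of $G$ with both ends in $X$; $\mathsf{cc}(X)$ is its number of connected components; $\partial X$ is the set of vertices outside $X$ joined to $X$ by an edge. For $\lambda\in\mathbb R$, $\mathcal A_\lambda(G)$ is the set of all $X\subset V(G)$ which induce an acyclic subgraph, each connected component of which has $\lambda$ in the spectrum of its induced Jacobi operator, and such that $\mathsf{cc}(X)-|\partial X|>0$. *)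

(* Defs.v *)
From HB Require Import structures.
From mathcomp Require Import all_boot all_order all_algebra.
From mathcomp Require Import complex.
From mathcomp Require Import all_classical all_reals all_analysis.

Set Implicit Arguments.
Unset Strict Implicit.
Unset Printing Implicit Defensive.

Import Order.TTheory GRing.Theory Num.Theory.
Import numFieldNormedType.Exports.

Local Open Scope classical_set_scope.
Local Open Scope ring_scope.
Local Open Scope complex_scope.

(** * Weighted graphs with potential *)

(* Self-loops and multiple edges are allowed.  [rev] is the involution
   e |-> e-check, and reality of the potential is expressed by its type. *)
Record graph (R : realType) (V E : choiceType) := Graph {
  src : E -> V;
  rev_edge : E -> E;
  weight : E -> R[i];
  pot : V -> R;
  rev_edgeK : involutive rev_edge;
  rev_edge_neq : forall e, rev_edge e != e;
  weight_herm : forall e, weight (rev_edge e) = conjc (weight e)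
}.

Definition tgt (R : realType) (V E : choiceType) (G : graph R V E) (e : E) : V :=
  src G (rev_edge G e).

(* f may follow e in a non-backtracking walk *)
Definition nb_step (R : realType) (V E : choiceType) (G : graph R V E) : rel E :=
  fun e f => (tgt G e == src G f) && (e != rev_edge G f).

Definition acyclic (R : realType) (V E : choiceType) (G : graph R V E) : Prop :=
  ~ exists (e : E) (s : seq E),
      path (nb_step G) e s /\ tgt G (last e s) = src G e.

(* The sum over the edges with terminal u is a finitely supported sum: it is
   meaningful whenever finitely many edges end at u. *)
Definition jacobi (R : realType) (V E : choiceType) (G : graph R V E)
    (eta : V -> R[i]) (u : V) : R[i] :=
  (pot G u)%:C * eta u
  + \sum_(e \in [set e | tgt G e = u]) weight G e * eta (src G e).

(** * Finite graphs *)

(* The Jacobi operator of a finite graph, on the space of all functions on V *)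
Definition jacobi_fun (R : realType) (V E : finType) (G : graph R V E)
    (eta : {ffun V -> R[i]^o}) : {ffun V -> R[i]^o} :=
  [ffun u => jacobi G eta u].

Definition jacobi_op (R : realType) (V E : finType) (G : graph R V E) :
    'End({ffun V -> R[i]^o}) :=
  linfun (jacobi_fun G).

Lemma jacobi_fun_linear (R : realType) (V E : finType) (G : graph R V E) :
  linear (jacobi_fun G).
Proof.
move=> k x y; apply/ffunP => u; rewrite !ffunE /jacobi !ffunE.
rewrite !fsbig_finite; do ?exact: finite_finset.
rewrite scalerDr mulrDr -!addrA; congr (_ + _).
  by rewrite /GRing.scale /= mulrCA.
rewrite addrCA; congr (_ + _).
rewrite scaler_sumr -big_split /=; apply: eq_bigr => e _.
by rewrite !ffunE mulrDr; congr (_ + _); rewrite /GRing.scale /= mulrCA.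
Qed.

Lemma jacobi_opE (R : realType) (V E : finType) (G : graph R V E)
    (eta : {ffun V -> R[i]^o}) (u : V) :
  jacobi_op G eta u = jacobi G eta u.
Proof.
pose f : {linear {ffun V -> R[i]^o} -> {ffun V -> R[i]^o}} :=
  HB.pack (jacobi_fun G) (GRing.isLinear.Build _ _ _ _ _ (jacobi_fun_linear G)).
by rewrite /jacobi_op (lfunE f) ffunE.
Qed.

Definition in_spec (R : realType) (V E : finType) (G : graph R V E) (lam : R) : bool :=
  passmx.leigenvalue (jacobi_op G) lam%:C.

(* The operator is Hermitian, so the multiplicity of an eigenvalue is the
   dimension of its eigenspace. *)
Definition spec_mult (R : realType) (V E : finType) (G : graph R V E) (lam : R) : nat :=
  \dim (passmx.leigenspace (jacobi_op G) lam%:C).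

Definition adj (R : realType) (V E : finType) (G : graph R V E) : rel V :=
  fun u v => [exists e, (src G e == u) && (tgt G e == v)].

Definition connected_graph (R : realType) (V E : finType) (G : graph R V E) : Prop :=
  forall u v, connect (adj G) u v.

Section Induced.
Variables (R : realType) (V E : finType) (G : graph R V E) (X : {set V}).

Definition ivertex : Type := {u : V | u \in X}.
Definition iedge : Type := {e : E | (src G e \in X) && (tgt G e \in X)}.
HB.instance Definition _ := Finite.on ivertex.
HB.instance Definition _ := Finite.on iedge.

Lemma isrc_subproof (e : iedge) : src G (val e) \in X.
Proof. by case/andP: (valP e). Qed.

Lemma irev_subproof (e : iedge) :
  (src G (rev_edge G (val e)) \in X) && (tgt G (rev_edge G (val e)) \in X).
Proof. by rewrite /tgt rev_edgeK andbC; exact: (valP e). Qed.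

Definition isrc (e : iedge) : ivertex := Sub (src G (val e)) (isrc_subproof e).
Definition irev (e : iedge) : iedge := Sub (rev_edge G (val e)) (irev_subproof e).

Lemma irevK : involutive irev.
Proof. by move=> e; apply: val_inj; rewrite /= rev_edgeK. Qed.

Lemma irev_neq (e : iedge) : irev e != e.
Proof. by rewrite -val_eqE /= rev_edge_neq. Qed.

Definition induced : graph R ivertex iedge :=
  @Graph R ivertex iedge isrc irev
    (fun e => weight G (val e)) (fun u => pot G (val u))
    irevK irev_neq (fun e => weight_herm G (val e)).

Definition adj_in : rel V := fun u v => [&& u \in X, v \in X & adj G u v].

(* the vertex sets of the connected components of the subgraph induced by X *)
Definition components : {set {set V}} :=
  [set [set v in X | connect adj_in u v] | u in X]%SET.

Definition cc : nat := #|components|.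

Definition boundary : {set V} :=
  [set v | (v \notin X) && [exists u in X, adj G u v]]%SET.

End Induced.

Definition calA (R : realType) (V E : finType) (G : graph R V E) (lam : R) :
    set {set V} :=
  [set X | [/\ acyclic (induced G X),
               forall C, C \in components G X -> in_spec (induced G C) lam
             & (#|boundary G X| < cc G X)%N]].

(** * Universal cover *)

Section UniversalCover.
Variables (R : realType) (V E : finType) (G : graph R V E) (r : V).

Definition nb_from (s : seq E) : bool :=
  if s is e :: s' then (src G e == r) && path (nb_step G) e s' else true.

Definition uvertex : Type := {s : seq E | nb_from s}.
HB.instance Definition _ := Choice.on uvertex.

(* Undirected edges of the cover: a walk w together with an edge e extending
   it.  The boolean is the orientation: [false] goes from w to its extension
   by e, and [true] goes back. *)
Definition uextension : Type := {p : uvertex * E | nb_from (rcons (val p.1) p.2)}.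
HB.instance Definition _ := Choice.on uextension.
Definition uedge : Type := (uextension * bool)%type.
HB.instance Definition _ := Choice.on uedge.

Definition ushort (x : uextension) : uvertex := (val x).1.
Definition ulong (x : uextension) : uvertex :=
  Sub (rcons (val (val x).1) (val x).2) (valP x).

Definition usrc (x : uedge) : uvertex := if x.2 then ulong x.1 else ushort x.1.
Definition urev (x : uedge) : uedge := (x.1, ~~ x.2).

(* the covering map *)
Definition Xi (w : uvertex) : V := last r (map (tgt G) (val w)).
Definition Xi_edge (x : uedge) : E :=
  if x.2 then rev_edge G (val x.1).2 else (val x.1).2.

Lemma urevK : involutive urev.
Proof. by case=> x b; rewrite /urev /= negbK. Qed.

Lemma urev_neq (x : uedge) : urev x != x.
Proof. by case: x => x b; rewrite /urev /= xpair_eqE; case: b; rewrite andbF. Qed.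

Lemma uweight_herm (x : uedge) :
  weight G (Xi_edge (urev x)) = conjc (weight G (Xi_edge x)).
Proof.
by case: x => x [] /=; rewrite /Xi_edge /= -weight_herm ?rev_edgeK.
Qed.

Definition ucover : graph R uvertex uedge :=
  @Graph R uvertex uedge usrc urev
    (fun x => weight G (Xi_edge x)) (fun w => pot G (Xi w))
    urevK urev_neq uweight_herm.

End UniversalCover.

(** * The Hilbert space of square-summable functions *)

Section L2.
Variables (R : realType) (I : choiceType).
Implicit Types (eta xi : I -> R[i]).

Definition sqnorm eta : \bar R :=
  (\esum_(u in [set: I]) ((complex.Re (eta u) ^+ 2 + complex.Im (eta u) ^+ 2)%:E))%E.

Definition l2 eta : Prop := (sqnorm eta < +oo)%E.

Definition l2norm eta : R := Num.sqrt (fine (sqnorm eta)).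

(* the sum of an absolutely summable real family *)
Definition rsum (f : I -> R) : R :=
  fine (\esum_(u in [set: I]) (Num.max (f u) 0)%:E)
  - fine (\esum_(u in [set: I]) (Num.max (- f u) 0)%:E).

Definition l2dot eta xi : R[i] :=
  rsum (fun u => complex.Re (conjc (eta u) * xi u))
  +i* rsum (fun u => complex.Im (conjc (eta u) * xi u)).

Definition delta (v : I) : I -> R[i] := fun u => (u == v)%:R.

Definition opnorm_le (B : (I -> R[i]) -> (I -> R[i])) (M : R) : Prop :=
  forall eta, l2 eta -> l2norm (B eta) <= M * l2norm eta.

(* B restricts to a bounded linear operator on l2; its values outside of l2
   are irrelevant *)
Definition bounded_operator (B : (I -> R[i]) -> (I -> R[i])) : Prop :=
  [/\ forall eta, l2 eta -> l2 (B eta),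
      forall (c : R[i]) eta xi, l2 eta -> l2 xi ->
        B (fun u => c * eta u + xi u) = (fun u => c * B eta u + B xi u)
    & exists M : R, opnorm_le B M].

Definition selfadjoint (B : (I -> R[i]) -> (I -> R[i])) : Prop :=
  forall eta xi, l2 eta -> l2 xi -> l2dot (B eta) xi = l2dot eta (B xi).

Definition bounded_measurable (f : R -> R) : Prop :=
  measurable_fun [set: measurableTypeR R] f /\ exists M : R, forall x, `|f x| <= M.

(* f |-> Phi f is the bounded Borel functional calculus f |-> f(A) of the
   bounded self-adjoint operator A.  By the spectral theorem it exists and is
   unique; real-valued f suffice since f(A) is complex-linear in f. *)
Record borel_calculus (A : (I -> R[i]) -> (I -> R[i]))
    (Phi : (R -> R) -> (I -> R[i]) -> (I -> R[i])) : Prop := BorelCalculus {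
  bc_bounded : forall f, bounded_measurable f -> bounded_operator (Phi f);
  bc_selfadjoint : forall f, bounded_measurable f -> selfadjoint (Phi f);
  bc_one : forall eta, l2 eta -> Phi (fun=> 1) eta = eta;
  bc_scale : forall (c : R) f eta, bounded_measurable f -> l2 eta ->
    Phi (fun x => c * f x) eta = (fun u => c%:C * Phi f eta u);
  bc_add : forall f g eta, bounded_measurable f -> bounded_measurable g -> l2 eta ->
    Phi (fun x => f x + g x) eta = (fun u => Phi f eta u + Phi g eta u);
  bc_mul : forall f g eta, bounded_measurable f -> bounded_measurable g -> l2 eta ->
    Phi (fun x => f x * g x) eta = Phi f (Phi g eta);
  (* id(A) = A, where id is truncated outside of an interval containing the
     spectrum of A in order to be bounded *)
  bc_id : forall (M : R) eta, opnorm_le A M -> l2 eta ->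
    Phi (fun x => if `|x| <= M then x else 0) eta = A eta;
  bc_norm : forall f (M : R), bounded_measurable f -> (forall x, `|f x| <= M) ->
    opnorm_le (Phi f) M;
  bc_continuous : forall (f_ : nat -> R -> R) f (M : R) eta,
    (forall n, bounded_measurable (f_ n)) ->
    (forall n x, `|f_ n x| <= M) ->
    (forall x, f_ ^~ x @ \oo --> f x) -> l2 eta ->
    (fun n => l2norm (fun u => Phi (f_ n) eta u - Phi f eta u)) @ \oo --> (0 : R)
}.

End L2.

Definition point_spectrum (R : realType) (V E : choiceType) (G : graph R V E) : set R :=
  [set lam | exists eta : V -> R[i],
     [/\ l2 eta, exists u, eta u != 0
       & forall u, jacobi G eta u = lam%:C * eta u]].

(** * Spectral measures and density of states of the universal cover *)

Definition spectral_measure (R : realType) (V E : finType) (G : graph R V E) (r : V)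
    (Phi : (R -> R) -> (uvertex G r -> R[i]) -> (uvertex G r -> R[i])) (u : V)
    (mu : {measure set (measurableTypeR R) -> \bar R}) : Prop :=
  forall (w : uvertex G r) (f : R -> R), Xi w = u -> bounded_measurable f ->
    mu.-integrable [set: measurableTypeR R] (fun x => (f x)%:E) /\
    l2dot (delta R w) (Phi f (delta R w)) = (\int[mu]_x f x)%:C.

Definition density_of_states (R : realType) (V E : finType) (G : graph R V E) (r : V)
    (mu : {measure set (measurableTypeR R) -> \bar R}) : Prop :=
  exists (Phi : (R -> R) -> (uvertex G r -> R[i]) -> (uvertex G r -> R[i]))
         (mu_ : V -> {measure set (measurableTypeR R) -> \bar R}),
    [/\ borel_calculus (jacobi (ucover G r)) Phi,
        forall u, spectral_measure Phi u (mu_ u)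
      & forall B : set (measurableTypeR R), measurable B ->
          mu B = ((#|V|%:R^-1)%:E * \sum_(u : V) mu_ u B)%E].

(* Main.v *)
(* The cc(X) eigenfunctions of the components of X, extended by zero, have
   disjoint supports, and A_G - lam maps their span into the functions supported
   on the boundary of X; this gives (i) by counting dimensions.

   For (ii), the same count is made on finite covers of G. As X is acyclic, each
   of its components lifts to every sheet, so on a cover with n sheets lam has
   multiplicity at least n (cc(X) - |bd X|). Hence, choosing above each vertex u
   the point y where the orthogonal projection P to the eigenspace has the largest
   diagonal entry p_u = P(y, y), one has sum_u p_u >= cc(X) - |bd X|, and
   f = P delta_y is an eigenfunction with f(y) = |f|^2 = p_u. Pulled back to the
   universal cover it is still an eigenfunction, and its norm on a ball is at most
   that of f as soon as the ball is mapped injectively to the cover. Along covers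
   which are injective on larger and larger balls, limits along an ultrafilter
   give l2 eigenfunctions g_u with g_u(w_u) = p_u >= |g_u|^2, w_u above u.

   Finally, if Q is the spectral projection of A_T at lam and q = mu_u{lam}, then
   Q g_u = g_u and 0 <= |g_u - Q delta_{w_u}|^2 <= p_u - 2 p_u + q, so p_u <= q. *)
Require Import Defs.
From mathcomp Require Import all_boot all_order all_algebra all_fingroup.
From mathcomp Require Import complex ring lra.
From mathcomp Require Import all_classical all_reals all_analysis.
From mathcomp Require Import measurable_realfun.

Set Implicit Arguments.
Unset Strict Implicit.
Unset Printing Implicit Defensive.

Import Order.TTheory GRing.Theory Num.Theory.
Import numFieldNormedType.Exports.

Local Open Scope classical_set_scope.
Local Open Scope ring_scope.
Local Open Scope complex_scope.

(** * Linear algebra *)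

(** The squared modulus as an element of [R], since the norm of [R[i]] is itself complex; it is the
    summand of [sqnorm]. *)
Definition csq (R : realType) (z : R[i]) : R := complex.Re z ^+ 2 + complex.Im z ^+ 2.

Lemma csq_ge0 (R : realType) (z : R[i]) : 0 <= csq z.
Proof. by rewrite addr_ge0 ?sqr_ge0. Qed.

Lemma csqE (R : realType) (z : R[i]) : (csq z)%:C = z^* * z.
Proof.
case: z => x y; rewrite /csq /=; apply/eqP; rewrite eq_complex /=.
by rewrite -!expr2 mulNr opprK eqxx mulNr mulrC subrr eqxx.
Qed.

Lemma csqM (R : realType) (z t : R[i]) : csq (z * t) = csq z * csq t.
Proof. case: z t => [x y] [a b]; rewrite /csq /=; ring. Qed.

(** Disjoint supports make the family free, and [T] maps its span into the functions supported on
    [B], a space of dimension at most [#|B|]. Rank-nullity for [T] on this span concludes. *)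
Lemma dim_lker_disjoint (K : fieldType) (I J : finType)
    (T : 'End({ffun I -> K^o})) (psi : J -> {ffun I -> K^o}) (B : {set I}) :
  (forall j, exists i, psi j i != 0) ->
  (forall j j' i, psi j i != 0 -> psi j' i != 0 -> j = j') ->
  (forall j i, i \notin B -> T (psi j) i = 0) ->
  (#|J| - #|B| <= \dim (lker T))%N.
Proof.
move=> psi_neq0 psi_disj psiB.
pose X := [tuple psi (enum_val i) | i < #|J|].
have Xfree : free X.
  apply/freeP => k k0 i.
  have [v v0] := psi_neq0 (enum_val i).
  move/ffunP: k0 => /(_ v); rewrite ffunE sum_ffunE (bigD1 i)//= big1 => [|i' i'i].
    rewrite ffunE (nth_map i) ?size_enum_ord// nth_ord_enum addr0.
    by move/eqP; rewrite mulf_eq0 (negbTE v0) orbF => /eqP.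
  rewrite ffunE (nth_map i) ?size_enum_ord// nth_ord_enum.
  apply/eqP; rewrite mulf_eq0; apply/orP; right.
  apply: contraNT i'i => /psi_disj/(_ v0) /enum_val_inj ->.
  exact: eqxx.
have dimX : \dim <<X>> = #|J| by rewrite (eqP Xfree) size_tuple.
pose D := [seq [ffun z => (z == b)%:R] : {ffun I -> K^o} | b <- enum B].
have dimD : (\dim <<D>> <= #|B|)%N.
  by rewrite (leq_trans (dim_span _))// size_map -cardE.
have TXD : (T @: <<X>> <= <<D>>)%VS.
  rewrite limg_span; apply/span_subvP => _ /mapP[f /mapP[i _ ->] ->].
  have -> : T (psi (enum_val i)) =
      \sum_(b <- enum B) T (psi (enum_val i)) b *:
        ([ffun z => (z == b)%:R] : {ffun I -> K^o}).
    apply/ffunP => z; rewrite sum_ffunE.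
    under eq_bigr do rewrite !ffunE.
    have [zB|zB] := boolP (z \in B).
      rewrite (bigD1_seq z) ?enum_uniq ?mem_enum//= eqxx big1 ?addr0.
        by rewrite /GRing.scale/= mulr1.
      by move=> b /negbTE bz; rewrite eq_sym bz scaler0.
    rewrite psiB// big_seq big1// => b; rewrite mem_enum => bB.
    by case: eqP bB => [<-|]; rewrite ?(negbTE zB) ?scaler0.
  rewrite big_seq; apply: memv_suml => b bB.
  by apply: memvZ; apply: memv_span; apply/mapP; exists b.
rewrite leq_subLR -dimX -(limg_ker_dim T <<X>>) addnC leq_add//.
  by rewrite (leq_trans (dimvS TXD)).
by rewrite dimvS// capvSr.
Qed.

(* [f y] is the orthogonal projection of the Dirac mass at [y] to [U] *)
Lemma reproducing_kernel (R : realType) (I : finType)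
    (U : {vspace {ffun I -> R[i]^o}}) :
  exists (p : I -> R) (f : I -> {ffun I -> R[i]^o}),
    [/\ forall y, f y \in U, forall y, f y y = (p y)%:C,
        forall y, \sum_z csq (f y z) = p y & \sum_y p y = (\dim U)%:R].
Proof.
(* The rows of [A] are a basis of [U]. Gram-Schmidt turns them into an orthonormal basis [q], and
   the kernel is the sum of the [(q i y)^* *: q i]. *)
pose A := \matrix_(i < \dim U, j < #|I|) (vbasis U)`_i (enum_val j).
have Afree : row_free A.
  rewrite -kermx_eq0 -submx0; apply/rV_subP => c /sub_kermxP cA.
  rewrite submx0; apply/eqP/rowP => i; rewrite mxE.
  move: (basis_free (vbasisP U)) => /freeP; apply => //.
  apply/ffunP => z; move/rowP: cA => /(_ (enum_rank z)); rewrite !mxE => cA.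
  rewrite sum_ffunE ffunE -[RHS]cA; apply: eq_bigr => j _.
  by rewrite !ffunE mxE enum_rankK.
have rkA : \rank A = \dim U by apply/eqP.
have Qu : schmidt A \is unitarymx by apply: schmidt_unitarymx; rewrite -rkA rank_leq_col.
have QA := eqmx_schmidt_free Afree.
set Q := schmidt A in Qu QA.
pose q i : {ffun I -> R[i]^o} := [ffun z => Q i (enum_rank z)].
have qU i : q i \in U.
  have /submxP[D QD] : (row i Q <= A)%MS by rewrite -QA row_sub.
  have -> : q i = \sum_(j < \dim U) D 0 j *: (vbasis U)`_j.
    apply/ffunP => z; rewrite sum_ffunE ffunE.
    have -> : Q i (enum_rank z) = row i Q 0 (enum_rank z) by rewrite mxE.
    rewrite QD mxE; apply: eq_bigr => j _; rewrite ffunE !mxE enum_rankK.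
    by [].
  apply: memv_suml => j _; apply: memvZ; apply: vbasis_mem.
  by rewrite mem_nth// size_tuple.
have qq i j : \sum_z q i z * (q j z)^* = (i == j)%:R.
  move/unitarymxP: Qu => /matrixP/(_ i j); rewrite !mxE => <-.
  rewrite (reindex_onto enum_rank enum_val) => [|k _]; last exact: enum_valK.
  apply: eq_big => z; first by rewrite enum_rankK eqxx.
  by move=> _; rewrite !ffunE !mxE.
exists (fun y => \sum_i csq (q i y)), (fun y => \sum_i (q i y)^* *: q i).
have re (x y : R) : x%:C = y%:C -> x = y by case.
split.
- by move=> y; apply: memv_suml => i _; apply: memvZ.
- move=> y; rewrite sum_ffunE rmorph_sum/=; apply: eq_bigr => i _.
  by rewrite csqE ffunE.
- move=> y; apply: re; rewrite !rmorph_sum/=.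
  transitivity (\sum_z \sum_i \sum_j (q i y)^* * q j y * (q i z * (q j z)^*)).
    apply: eq_bigr => z _; rewrite csqE sum_ffunE rmorph_sum/= mulrC big_distrlr/=.
    apply: eq_bigr => i _; apply: eq_bigr => j _.
    by rewrite !ffunE rmorphM/= conjCK /GRing.scale/= mulrACA.
  rewrite exchange_big/=; apply: eq_bigr => i _.
  rewrite exchange_big/= (bigD1 i)//= [X in _ + X]big1 => [|j ji].
    by rewrite -mulr_sumr qq eqxx mulr1 addr0 csqE.
  by rewrite -mulr_sumr qq eq_sym (negbTE ji) mulr0.
(* The trace of the projection: each of the [\dim U] unit vectors [q i] contributes 1. *)
- apply: re; rewrite rmorph_sum/= rmorph_nat.
  under eq_bigr do rewrite rmorph_sum/=.
  transitivity (\sum_(i < \dim U) 1 : R[i]); last by rewrite sumr_const card_ord.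
  rewrite exchange_big/=; apply: eq_bigr => i _; transitivity (\sum_z q i z * (q i z)^*).
    by apply: eq_bigr => z _; rewrite csqE mulrC.
  by rewrite qq eqxx.
Qed.

(** * Eigenfunctions of finite graphs *)

Section FiniteGraph.
Variables (R : realType) (V E : finType) (G : graph R V E).

Lemma jacobi_finE (eta : V -> R[i]) (u : V) :
  jacobi G eta u =
  (pot G u)%:C * eta u + \sum_(e | tgt G e == u) weight G e * eta (src G e).
Proof.
rewrite /jacobi; congr (_ + _).
rewrite (@bigfs _ _ _ _ (index_enum E)) ?index_enum_uniq//; last first.
  by move=> e _; rewrite mem_index_enum.
by apply: eq_fsbigl; apply/seteqP; split=> e /eqP.
Qed.

Lemma mem_eigenspace (lam : R) (eta : {ffun V -> R[i]^o}) :
  eta \in passmx.leigenspace (jacobi_op G) lam%:C <->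
  forall u, jacobi G eta u = lam%:C * eta u.
Proof.
rewrite memv_ker !(add_lfunE, opp_lfunE, scale_lfunE, id_lfunE) subr_eq0.
split => [/eqP/ffunP H u|H].
  by rewrite -jacobi_opE H !ffunE.
by apply/eqP/ffunP => u; rewrite jacobi_opE H !ffunE.
Qed.

Lemma in_specP (lam : R) :
  in_spec G lam <-> exists eta : {ffun V -> R[i]^o},
    (exists u, eta u != 0) /\ forall u, jacobi G eta u = lam%:C * eta u.
Proof.
rewrite /in_spec /passmx.leigenvalue; split.
  rewrite -vpick0; set eta := vpick _ => eta0.
  exists eta; split; last by apply/mem_eigenspace; exact: memv_pick.
  apply: contrapT => /forallNP H; case/eqP: eta0; apply/ffunP => u.
  by rewrite ffunE; apply/eqP; apply: contrapT => /negP; exact: H.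
move=> [eta [[u eta0] /mem_eigenspace etaE]]; apply: contra eta0 => /eqP E0.
by move: etaE; rewrite E0 memv0 => /eqP ->; rewrite ffunE.
Qed.

(** This is [dim_lker_disjoint] for the operator [A_G - lam], whose kernel is the eigenspace. *)
Lemma spec_mult_disjoint (J : finType) (psi : J -> V -> R[i]) (B : {set V})
    (lam : R) :
  (forall j, exists i, psi j i != 0) ->
  (forall j j' i, psi j i != 0 -> psi j' i != 0 -> j = j') ->
  (forall j u, u \notin B -> jacobi G (psi j) u = lam%:C * psi j u) ->
  (#|J| - #|B| <= spec_mult G lam)%N.
Proof.
move=> psi_neq0 psi_disj psiB.
apply: (@dim_lker_disjoint _ _ _ _ (fun j => [ffun u => psi j u] : {ffun V -> R[i]^o})).
- by move=> j; have [i ?] := psi_neq0 j; exists i; rewrite ffunE.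
- by move=> j j' i; rewrite !ffunE; exact: psi_disj.
- move=> j u uB; rewrite !(add_lfunE, opp_lfunE, scale_lfunE, id_lfunE) !ffunE jacobi_opE.
  rewrite (_ : [ffun u => psi j u] = psi j :> (V -> R[i])); last first.
    by apply/funext => v; rewrite ffunE.
  by rewrite psiB// /GRing.scale/= subrr.
Qed.

End FiniteGraph.

(** * Eigenfunctions carried by the components of [X] *)

Section Components.
Variables (R : realType) (V E : finType) (G : graph R V E) (X : {set V}).

Lemma adj_sym : symmetric (adj G).
Proof.
move=> u v; apply/existsP/existsP => -[e /andP[/eqP eu /eqP ev]];
  by exists (rev_edge G e); rewrite /tgt rev_edgeK [src G (rev_edge G e)]ev eu !eqxx.
Qed.

Lemma connect_adj_in_sym : connect_sym (adj_in G X).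
Proof. by apply: sym_connect_sym => u v; rewrite /adj_in adj_sym andbCA. Qed.

Lemma adj_in_edge e : src G e \in X -> tgt G e \in X ->
  adj_in G X (src G e) (tgt G e).
Proof.
by move=> sX tX; rewrite /adj_in sX tX; apply/existsP; exists e; rewrite !eqxx.
Qed.

Lemma component_sub C : C \in components G X -> C \subset X.
Proof. by case/imsetP => u uX ->; apply/fintype.subsetP => v; rewrite inE => /andP[]. Qed.

Lemma component_disjoint C C' v : C \in components G X ->
  C' \in components G X -> v \in C -> v \in C' -> C = C'.
Proof.
case/imsetP => u uX ->; case/imsetP => u' u'X ->; rewrite !inE.
move=> /andP[vX uv] /andP[_ u'v]; apply/setP => w; rewrite !inE.
by rewrite (same_connect connect_adj_in_sym uv) (same_connect connect_adj_in_sym u'v).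
Qed.

Lemma component_edge C e : C \in components G X -> tgt G e \in X ->
  src G e \in C -> tgt G e \in C.
Proof.
case/imsetP => u uX ->; rewrite !inE => tX /andP[sX us]; rewrite tX/=.
by rewrite (connect_trans us)// connect1// adj_in_edge.
Qed.

(** Extend an eigenfunction of the component by zero. At a vertex of [C] the edges from outside
    contribute nothing, which leaves the induced operator. A vertex outside [C] with a neighbour in
    [C] cannot lie in [X], so it is in the boundary. *)
Lemma component_eigenfunction C (lam : R) : C \in components G X ->
  in_spec (Defs.induced G C) lam ->
  exists psi : V -> R[i], [/\ exists v, psi v != 0,
    forall v, psi v != 0 -> v \in C
    & forall v, v \notin boundary G X -> jacobi G psi v = lam%:C * psi v].
Proof.
move=> HC; rewrite in_specP => -[eta [[u etau] etaE]].
pose psi v := if insub v is Some v' then eta v' else 0.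
have psi_val (v : ivertex C) : psi (val v) = eta v by rewrite /psi valK.
have psi_out v : v \notin C -> psi v = 0 by move=> vC; rewrite /psi insubN.
exists psi; split.
- by exists (val u); rewrite psi_val.
- by move=> v; apply: contraR => /psi_out ->.
move=> v vB; have CX := fintype.subsetP (component_sub HC).
have [vC|vC] := boolP (v \in C); last first.
  rewrite jacobi_finE psi_out// !mulr0 add0r big1// => e /eqP ev.
  rewrite psi_out ?mulr0//; apply: contra vC => sC.
  have [vX|vX] := boolP (v \in X); first by rewrite -ev (component_edge HC)// ev.
  case/negP: vB; rewrite inE vX; apply/existsP; exists (src G e); rewrite CX//.
  by apply/existsP; exists e; rewrite ev !eqxx.
have -> : v = val (Sub v vC : ivertex C) by rewrite SubK.
move: (Sub v vC) => w; rewrite psi_val -etaE !jacobi_finE psi_val; congr (_ + _).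
rewrite (bigID (fun e => src G e \in C))/= [X in _ + X]big1 ?addr0; last first.
  by move=> e /andP[_ /psi_out ->]; rewrite mulr0.
rewrite (eq_bigl (fun e => ((src G e \in C) && (tgt G e \in C)) &&
    (tgt G e == val w))); last first.
  move=> e; have wC : val w \in C := valP w.
  case: (tgt G e =P val w) => [ew|_]; last by rewrite andbF.
  by rewrite ew wC !andbT.
rewrite (reindex_omap (val : iedge G C -> E) insub); last first.
  by move=> e /andP[eC _]; rewrite insubT.
apply: eq_big => [e|e _]; last by rewrite -psi_val.
by rewrite valK eqxx andbT (valP e) -val_eqE.
Qed.

End Components.

(** * Finite covers *)

Section Walks.
Variables (R : realType) (V E : finType) (G : graph R V E) (X : {set V}).

Fixpoint walk_in (u : V) (w : seq E) : bool :=
  if w is e :: w' then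
    [&& src G e == u, src G e \in X, tgt G e \in X & walk_in (tgt G e) w']
  else true.

Definition walk_end (u : V) (w : seq E) : V := last u (map (tgt G) w).

Definition walk_rev (w : seq E) : seq E := rev (map (rev_edge G) w).

Lemma walk_in_cat u w1 w2 :
  walk_in u (w1 ++ w2) = walk_in u w1 && walk_in (walk_end u w1) w2.
Proof. by elim: w1 u => //= e w1 IH u; rewrite IH -!andbA. Qed.

Lemma walk_end_cat u w1 w2 :
  walk_end u (w1 ++ w2) = walk_end (walk_end u w1) w2.
Proof. by rewrite /walk_end map_cat last_cat. Qed.

Lemma walk_rev_cons e w : walk_rev (e :: w) = walk_rev w ++ [:: rev_edge G e].
Proof. by rewrite /walk_rev /= rev_cons cats1. Qed.

Lemma tgt_rev_edge e : tgt G (rev_edge G e) = src G e.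
Proof. by rewrite /tgt rev_edgeK. Qed.

Lemma walk_revP u w : walk_in u w ->
  walk_in (walk_end u w) (walk_rev w) /\ walk_end (walk_end u w) (walk_rev w) = u.
Proof.
elim: w u => //= e w IH u /and4P[/eqP eu sX tX ew].
have [IH1 IH2] := IH _ ew.
rewrite walk_rev_cons walk_in_cat walk_end_cat.
rewrite -[walk_end u _]/(walk_end (tgt G e) w) IH1 IH2 /walk_end/= tgt_rev_edge.
by rewrite -[src G (rev_edge G e)]/(tgt G e) eqxx sX tX.
Qed.

Lemma walk_backtrack u e w : walk_in u (e :: w) -> ~~ path (nb_step G) e w ->
  exists w1 f w2, e :: w = w1 ++ f :: rev_edge G f :: w2.
Proof.
elim: w u e => //= f w IH u e /and4P[eu sX tX fw].
have /and4P[/eqP fe _ _ _] := fw.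
rewrite negb_and => /orP[|/(IH (tgt G e) f fw)[w1 [g [w2 ->]]]]; last first.
  by exists (e :: w1), g, w2.
rewrite /nb_step fe eqxx/= negbK => /eqP ef.
by exists [::], e, w; rewrite ef rev_edgeK.
Qed.

Lemma walk_in_all u e w : walk_in u (e :: w) ->
  all [pred f | (src G f \in X) && (tgt G f \in X)] (e :: w).
Proof.
elim: w u e => [|f w IH] u e /and4P[_ sX tX]; first by rewrite /= sX tX.
by move=> /IH /=; rewrite sX tX.
Qed.

(** All edges of the walk have both ends in [X], so a closed one would be a closed non-backtracking
    walk of the induced graph. *)
Lemma acyclic_walk u e w : acyclic (Defs.induced G X) ->
  walk_in u (e :: w) -> path (nb_step G) e w -> walk_end u (e :: w) != u.
Proof.
move=> acyc ew pw; apply/negP => /eqP wu; apply: acyc.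
have /= /andP[eX wX] := walk_in_all ew.
have [w' ww'] : exists w' : seq (iedge G X), w = map val w'.
  elim: w wX {ew pw wu} => [|f w IH] /=; first by exists [::].
  by move=> /andP[fX /IH[w' ->]]; exists (Sub f fX :: w').
have sub_nb : nb_step (Defs.induced G X) =2 relpre val (nb_step G).
  by move=> f g; rewrite /nb_step /= -!val_eqE.
exists (Sub e eX), w'; split.
  by rewrite (eq_path sub_nb) -path_map -ww'.
apply/val_inj => /=.
move: wu; rewrite /walk_end/= last_map ww' => wu.
have /and4P[/eqP -> _ _ _] := ew.
by rewrite -[RHS]wu [in RHS](last_map val w' (Sub e eX : iedge G X)).
Qed.

Variables (S : Type) (s : E -> S -> S).
Hypothesis sK : forall e, cancel (s e) (s (rev_edge G e)).

(** The sheet reached from [x] by lifting [w] to a cover in which crossing [e] moves the sheets by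
    [s e]. *)
Definition holonomy (x : S) (w : seq E) : S := foldl (fun x e => s e x) x w.

Lemma holonomy_cat x w1 w2 : holonomy x (w1 ++ w2) = holonomy (holonomy x w1) w2.
Proof. exact: foldl_cat. Qed.

Lemma holonomy_rev x w : holonomy (holonomy x w) (walk_rev w) = x.
Proof.
elim: w x => //= e w IH x.
by rewrite walk_rev_cons holonomy_cat IH /= sK.
Qed.

(** A nonempty closed walk in a forest must backtrack somewhere. Deleting an edge followed by its
    reverse changes neither the ends nor the holonomy, so induction on the length applies. *)
Lemma holonomy_closed x u w : acyclic (Defs.induced G X) ->
  walk_in u w -> walk_end u w = u -> holonomy x w = x.
Proof.
move=> acyc; have [n] := ubnP (size w); elim: n w x => // n IH [//|e w] x wn ew wu.
have [/(acyclic_walk acyc ew)|] := boolP (path (nb_step G) e w).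
  by rewrite wu eqxx.
move=> /(walk_backtrack ew) [w1 [f [w2 eqw]]].
move: ew wu wn; rewrite eqw walk_in_cat walk_end_cat size_cat /=.
rewrite tgt_rev_edge => /andP[ww1 /and4P[/eqP fw1 sX tX /and4P[_ _ _ ww2]]] wu wn.
rewrite holonomy_cat/= sK -holonomy_cat; apply: IH.
- by move: wn; rewrite size_cat !addnS ltnS => /ltnW.
- by rewrite walk_in_cat ww1 -fw1.
- by rewrite -{2}wu walk_end_cat -fw1 /walk_end /= tgt_rev_edge.
Qed.

Lemma connect_walk u v : connect (adj_in G X) u v ->
  exists w, walk_in u w /\ walk_end u w = v.
Proof.
case/connectP => p; elim: p u => [u _ ->|v' p IH u]; first by exists [::].
move=> /= /andP[/and3P[uX v'X /existsP[e /andP[/eqP eu /eqP ev']]] pp] vE.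
have [w [ww wv]] := IH _ pp vE.
by exists (e :: w); rewrite /walk_end/= eu ev' uX v'X eqxx ww.
Qed.

(* On a forest the sheets can be trivialised over each component. *)
Lemma acyclic_potential : acyclic (Defs.induced G X) ->
  exists theta : V -> S -> S, (forall v, injective (theta v)) /\
    forall e x, src G e \in X -> tgt G e \in X ->
      theta (tgt G e) x = s e (theta (src G e) x).
Proof.
move=> acyc; pose rt := fingraph.root (adj_in G X).
have csym := connect_adj_in_sym G X.
have rtw v : {w | walk_in (rt v) w /\ walk_end (rt v) w = v}.
  by apply/cid/connect_walk; rewrite csym connect_root.
(* [theta v] is the transport along a chosen walk from the root of the component of [v] to [v]. *)
exists (fun v x => holonomy x (sval (rtw v))); split.
  by move=> v; apply: (can_inj (g := holonomy^~ (walk_rev (sval (rtw v))))) => x;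
    rewrite holonomy_rev.
move=> e x sX tX.
have rte : rt (src G e) = rt (tgt G e).
  by apply/(fingraph.rootP csym); apply: connect1; exact: adj_in_edge.
case: (rtw (src G e)) (rtw (tgt G e)) => /= w1 [ww1 w1e] [w2 [ww2 w2e]] /=.
have [rw2 rw2e] := walk_revP ww2.
rewrite w2e -rte in rw2 rw2e.
(* From the root to [src G e], across [e], then back to the root: this walk is closed, hence has
   trivial holonomy. *)
have /(congr1 (fun y => holonomy y w2)) :
    holonomy x (w1 ++ e :: walk_rev w2) = x.
  apply: (@holonomy_closed _ (rt (src G e))) => //.
    by rewrite walk_in_cat ww1 w1e /= eqxx sX tX rw2.
  by rewrite walk_end_cat w1e.
rewrite holonomy_cat /= => <-.
have {2}-> : w2 = walk_rev (walk_rev w2).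
  by rewrite /walk_rev map_rev revK mapK//; exact: rev_edgeK.
by rewrite holonomy_rev.
Qed.

End Walks.

Lemma component_eigenfamily (R : realType) (V E : finType) (G : graph R V E)
    (X : {set V}) (lam : R) :
  (forall C, C \in components G X -> in_spec (Defs.induced G C) lam) ->
  exists psi : {C | C \in components G X} -> V -> R[i],
    [/\ forall C, exists v, psi C v != 0,
        forall C C' v, psi C v != 0 -> psi C' v != 0 -> C = C',
        forall C v, psi C v != 0 -> v \in X
      & forall C v, v \notin boundary G X ->
          jacobi G (psi C) v = lam%:C * psi C v].
Proof.
move=> Xspec.
have /all_sig[psi psiP] (C : {C | C \in components G X}) :
    {psi : V -> R[i] | [/\ exists v, psi v != 0,
    forall v, psi v != 0 -> v \in val C
    & forall v, v \notin boundary G X -> jacobi G psi v = lam%:C * psi v]}.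
  by apply/cid/component_eigenfunction; [exact: valP|apply: Xspec; exact: valP].
exists psi; split.
- by move=> C; have [] := psiP C.
- move=> C C' v vC vC'; apply/val_inj.
  have [_ /(_ _ vC) vC1 _] := psiP C; have [_ /(_ _ vC') vC1' _] := psiP C'.
  by apply: component_disjoint vC1 vC1'; exact: valP.
- move=> C v vC; have [_ /(_ _ vC) vC1 _] := psiP C.
  exact: (fintype.subsetP (component_sub (valP C))).
- by move=> C v vB; have [_ _] := psiP C; apply.
Qed.

(** * Covers with sheets permuted along the edges *)

Section SheetCover.
Variables (R : realType) (V E : finType) (G : graph R V E).
Variables (S : finType) (s : E -> S -> S).
Hypothesis sK : forall e, cancel (s e) (s (rev_edge G e)).

(** The edge [(e, x)] leaves sheet [x] and arrives on sheet [s e x], where its reverse starts. *)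
Definition cover_rev (ex : E * S) : E * S := (rev_edge G ex.1, s ex.1 ex.2).

Lemma cover_revK : involutive cover_rev.
Proof. by move=> [e x]; rewrite /cover_rev/= rev_edgeK sK. Qed.

Lemma cover_rev_neq ex : cover_rev ex != ex.
Proof. by case: ex => e x; rewrite /cover_rev xpair_eqE negb_and rev_edge_neq. Qed.

Definition sheet_cover : graph R (V * S)%type (E * S)%type :=
  @Graph R _ _ (fun ex => (src G ex.1, ex.2)) cover_rev
    (fun ex => weight G ex.1) (fun vx => pot G vx.1)
    cover_revK cover_rev_neq (fun ex => weight_herm G ex.1).

Lemma jacobi_coverE (f : V * S -> R[i]) v x :
  jacobi sheet_cover f (v, x) = (pot G v)%:C * f (v, x) +
    \sum_(e | tgt G e == v) weight G e * f (src G e, s (rev_edge G e) x).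
Proof.
rewrite jacobi_finE; congr (_ + _).
have sK' e : cancel (s (rev_edge G e)) (s e).
  by move=> y; rewrite -{1}(rev_edgeK G e) sK.
rewrite (reindex_onto (fun e => (e, s (rev_edge G e) x)) fst).
  apply: eq_bigl => e /=; rewrite eqxx andbT.
  by rewrite /tgt/= /cover_rev/= sK' xpair_eqE eqxx andbT.
move=> [e y] /= /eqP[_ <-].
by rewrite sK.
Qed.

(** Each component has one lift per [h] in [S], the set of points [(v, theta v h)]. The lifted
    eigenfunctions have disjoint supports and fail the eigenvalue equation only above the boundary,
    which has [#|boundary G X| * #|S|] points. *)
Lemma sheet_cover_mult (X : {set V}) (lam : R) : calA G lam X ->
  (#|S| * (cc G X - #|boundary G X|) <= spec_mult sheet_cover lam)%N.
Proof.
move=> [acyc Xspec _].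
have [theta [theta_inj thetaE]] := acyclic_potential sK acyc.
have [psi [psi0 psi_disj psiX psiE]] := component_eigenfamily Xspec.
pose Psi (Ch : {C | C \in components G X} * S) (vx : V * S) : R[i] :=
  if vx.2 == theta vx.1 Ch.2 then psi Ch.1 vx.1 else 0.
have := @spec_mult_disjoint _ _ _ sheet_cover _ Psi
  (finset.setX (boundary G X) [set: S]%SET) lam.
rewrite card_prod card_sig cardsX cardsT -mulnBl mulnC; apply.
- move=> [C h]; have [v v0] := psi0 C.
  by exists (v, theta v h); rewrite /Psi/= eqxx.
- move=> [C h] [C' h'] [v x]; rewrite /Psi/=.
  case: (x =P theta v h) => [xh vC|_ /eqP//].
  case: (x =P theta v h') => [xh' vC'|_ /eqP//].
  have -> : h = h' by apply: (theta_inj v); rewrite -xh -xh'.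
  by rewrite (psi_disj _ _ _ vC vC').
move=> [C h] [v x]; rewrite finset.in_setX finset.in_setT andbT => vB.
transitivity ((x == theta v h)%:R * jacobi G (psi C) v); last first.
  by rewrite psiE// /Psi/= mulrCA; case: eqP => _; rewrite ?mul1r ?mul0r ?mulr0.
rewrite jacobi_coverE jacobi_finE mulrDr mulr_sumr; congr (_ + _).
  by rewrite /Psi/=; case: eqP => _; rewrite ?mul1r ?mul0r ?mulr0.
apply: eq_bigr => e /eqP ev; rewrite /Psi/= mulrCA; congr (_ * _).
(* Where [psi C] does not vanish at [src G e], both ends of [e] lie in [X], so [theta] follows [e]
   and the two points are on the same lift. *)
have [->|se] := eqVneq (psi C (src G e)) 0; first by rewrite mulr0 if_same.
have sX := psiX _ _ se.
have vX : v \in X.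
  apply: contraR vB => vX; rewrite inE vX; apply/existsP; exists (src G e).
  by rewrite sX; apply/existsP; exists e; rewrite ev !eqxx.
have -> : (s (rev_edge G e) x == theta (src G e) h) = (x == theta v h).
  rewrite -ev thetaE ?ev//; apply/eqP/eqP => [<-|->].
    by rewrite -{1}(rev_edgeK G e) sK.
  by rewrite sK.
by case: eqP => _; rewrite ?mul1r ?mul0r.
Qed.

End SheetCover.

Lemma calA_spec_mult (R : realType) (V E : finType) (G : graph R V E) (lam : R)
    (X : {set V}) : calA G lam X -> (cc G X - #|boundary G X| <= spec_mult G lam)%N.
Proof.
move=> [_ Xspec _].
have [psi [psi0 psi_disj psiX psiE]] := component_eigenfamily Xspec.
by rewrite /cc -card_sig; apply: (spec_mult_disjoint (psi := psi)).
Qed.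

(** * Sheets that separate short non-backtracking walks *)

Section Toggle.
Variables (E : eqType) (N : nat).
Implicit Types (e : E) (w : seq E).

(* The action of the generator e of a free product of copies of Z/2 on the
   reduced words of length at most N, the head of w being its last letter; it is
   trivial where the result would be too long, or on words that are not
   reduced. *)
Definition toggle e w : seq E :=
  if ohead w == Some e then
    if ohead (behead w) == Some e then w else behead w
  else if (size w < N)%N then e :: w else w.

Lemma size_toggle e w : (size w <= N)%N -> (size (toggle e w) <= N)%N.
Proof.
rewrite /toggle => wN; case: ifP => _; last by case: ifP.
by case: ifP => // _; rewrite size_behead (leq_trans (leq_pred _)).
Qed.

(** The trivial cases ensure this: [e] is never pushed onto a word starting with [e], and removing
    [e] never uncovers another [e]. *)
Lemma toggleK e w : (size w <= N)%N -> toggle e (toggle e w) = w.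
Proof.
move=> wN; rewrite {2}/toggle; case: ifPn => [|we].
  case: w wN => //= f w wN /eqP[->]; case: ifPn => [wf|wf].
    by rewrite /toggle/= eqxx wf.
  by rewrite /toggle (negbTE wf) wN.
case: ifPn => wN'; first by rewrite /toggle/= eqxx (negbTE we).
by rewrite /toggle (negbTE we) (negbTE wN').
Qed.

Definition toggle_bseq e (t : N.-bseq E) : N.-bseq E :=
  Bseq (size_toggle e (size_bseq t)).

Lemma toggle_bseqK e : involutive (toggle_bseq e).
Proof. by move=> t; apply/val_inj; rewrite /= toggleK// size_bseq. Qed.

End Toggle.

Definition toggle_perm (E : finType) (N : nat) (e : E) : {perm N.-bseq E} :=
  perm (inv_inj (@toggle_bseqK E N e)).

Section Sheets.
Variables (R : realType) (V E : finType) (G : graph R V E) (N : nat).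

(** An edge leaving side [b] and its reverse leaving the other side get the same label, so every
    undirected edge of the bipartite cover has a single label. *)
Definition label (b : bool) (e : E) : E := if b then rev_edge G e else e.

(* The alternating boolean makes the cover bipartite, and letting both
   directions of an edge act by the same involution becomes harmless. *)
Definition sheet_act (e : E) (x : bool * {perm N.-bseq E}) : bool * {perm N.-bseq E} :=
  (~~ x.1, (x.2 * toggle_perm N (label x.1 e))%g).

Lemma sheet_actK e : cancel (sheet_act e) (sheet_act (rev_edge G e)).
Proof.
move=> [b x]; rewrite /sheet_act/= negbK; congr (_, _).
rewrite -mulgA [(_ * toggle_perm _ _)%g](_ : _ = 1%g) ?mulg1//.
have -> : label (~~ b) (rev_edge G e) = label b e.
  by case: b => //=; rewrite rev_edgeK.
by apply/permP => t; rewrite permM !permE toggle_bseqK.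
Qed.

Fixpoint labels (b : bool) (w : seq E) : seq E :=
  if w is e :: w' then label b e :: labels (~~ b) w' else [::].

Lemma labels_inj b : injective (labels b).
Proof.
move=> w1; elim: w1 b => [|e w1 IH] b [|f w2]//= [ef /IH->]; congr (_ :: _).
by case: b ef => //=; exact: (inv_inj (rev_edgeK G)).
Qed.

(** As the sides alternate, two equal successive labels mean that the second edge reverses the
    first. *)
Lemma labels_neq b w : sorted (nb_step G) w -> sorted (fun e f => e != f) (labels b w).
Proof.
case: w => //= e w; elim: w b e => //= f w IH b e /andP[/andP[_ ef] fw].
rewrite IH// andbT; case: b => //=.
by apply: contra ef => /eqP <-; rewrite rev_edgeK.
Qed.

(** While the word stays reduced and of length at most [N], every generator pushes its letter. Only
    the top letter of [x a] could be cancelled, whence [take 1]. *)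
Lemma holonomy_labels b (x : {perm N.-bseq E}) w (a : N.-bseq E) :
  (size (x a) + size w <= N)%N ->
  sorted (fun e f => e != f) (take 1 (x a) ++ labels b w) ->
  (holonomy sheet_act (b, x) w).2 a = catrev (labels b w) (x a) :> seq E.
Proof.
elim: w b x => //= e w IH b x; rewrite addnS => szN sw.
have xa : (x * toggle_perm N (label b e))%g a = label b e :: x a :> seq E.
  rewrite permM permE /= /toggle ifN; last first.
    case: (bseqval (x a)) sw => //= f t; rewrite take0 => /andP[fl _].
    by apply: contra fl => /eqP[->].
  by rewrite (leq_trans _ szN)// ltnS leq_addr.
rewrite IH xa//=.
by rewrite take0; case: (bseqval (x a)) sw => //= f t; rewrite take0 => /andP[].
Qed.

(** Having permutations of words as sheets, rather than words, makes this hold from every sheet [x]: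
    some word [a] is sent by [x] to the empty word, and its final image spells the labels of the
    walk backwards. *)
Lemma holonomy_sheet_inj x w1 w2 : (size w1 <= N)%N -> (size w2 <= N)%N ->
  sorted (nb_step G) w1 -> sorted (nb_step G) w2 ->
  holonomy sheet_act x w1 = holonomy sheet_act x w2 -> w1 = w2.
Proof.
case: x => b x w1N w2N nb1 nb2 eqh.
pose a := (x^-1)%g (nil_bseq N E).
have xa : x a = nil_bseq N E by rewrite /a -permM mulVg perm1.
have := congr1 (fun y : bool * {perm N.-bseq E} => bseqval (y.2 a)) eqh.
rewrite !holonomy_labels xa//= ?labels_neq//.
by rewrite !catrevE !cats0 => /(can_inj (@revK _))/labels_inj.
Qed.

End Sheets.

(** * Square-summable functions *)

Section SquareSummable.
Variables (R : realType) (I : choiceType).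
Implicit Types (eta : I -> R[i]).

Lemma esum_leP (f : I -> R) (s : R) :
  (\esum_(u in [set: I]) (f u)%:E <= s%:E)%E <->
  forall t : seq I, uniq t -> \sum_(u <- t) f u <= s.
Proof.
split=> [H t tuniq|H].
  rewrite -lee_fin (le_trans _ H)//.
  apply: esum_ge; exists [set` t] => //.
  by rewrite -fsbig_seq// -sumEFin.
apply: ge_ereal_sup => _ [F [finF _] <-].
rewrite fsbig_finite//= sumEFin lee_fin; apply: H.
exact: finmap.fset_uniq.
Qed.

Lemma sqnorm_leP eta (s : R) : (sqnorm eta <= s%:E)%E <->
  forall t : seq I, uniq t -> \sum_(u <- t) csq (eta u) <= s.
Proof. exact: esum_leP. Qed.

Lemma sqnorm_ge0 eta : (0 <= sqnorm eta)%E.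
Proof. by apply: esum_ge0 => u _; rewrite lee_fin; exact: csq_ge0. Qed.

Lemma sqnormK eta : l2 eta -> (fine (sqnorm eta))%:E = sqnorm eta.
Proof. by move=> etal2; rewrite fineK// ge0_fin_numE// sqnorm_ge0. Qed.

Lemma sqnorm_finite_l2 eta (s : R) : (sqnorm eta <= s%:E)%E -> l2 eta.
Proof. by move=> /le_lt_trans; apply; exact: ltry. Qed.

End SquareSummable.

Lemma csqD_le (R : realType) (z t : R[i]) : csq (z + t) <= 2 * (csq z + csq t).
Proof.
case: z t => [x y] [x' y']; rewrite /csq/=.
have := sqr_ge0 (x - x'); have := sqr_ge0 (y - y').
rewrite !expr2; nra.
Qed.

(** The constant is crude, one factor 2 per term; it only serves to bound the Jacobi operator. *)
Lemma csq_sum_le (R : realType) (I : Type) (t : seq I) (P : pred I) (z : I -> R[i]) :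
  csq (\sum_(i <- t | P i) z i) <= 2 ^+ size t * \sum_(i <- t | P i) csq (z i).
Proof.
elim: t => [|i t IH]; first by rewrite !big_nil mulr0 /csq/= expr0n addr0.
rewrite !big_cons/= exprS -mulrA.
have [Pi|nPi] := boolP (P i); last first.
  rewrite (le_trans IH)// ler_peMl ?ler1n// mulr_ge0 ?exprn_ge0//.
  by apply: sumr_ge0 => j _; exact: csq_ge0.
rewrite (le_trans (csqD_le _ _))//.
rewrite ler_pM2l// mulrDr lerD// ler_peMl ?csq_ge0//.
by rewrite exprn_ege1// ler1n.
Qed.

Section L2.
Variables (R : realType) (I : choiceType).
Implicit Types (eta xi : I -> R[i]) (f : I -> R).

Lemma l2norm_eq0 eta : l2 eta -> l2norm eta = 0 -> forall u, eta u = 0.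
Proof.
move=> etal2 /eqP; rewrite /l2norm sqrtr_eq0 => eta0 u.
have : csq (eta u) <= 0.
  have : (sqnorm eta <= 0%:E)%E by rewrite -sqnormK// lee_fin.
  by move=> /sqnorm_leP/(_ [:: u] isT); rewrite big_seq1.
rewrite /csq; have := sqr_ge0 (complex.Re (eta u)); have := sqr_ge0 (complex.Im (eta u)).
move=> y0 x0 xy; apply/eqP; rewrite eq_complex/=.
rewrite -(sqrf_eq0 (complex.Re _)) -(sqrf_eq0 (complex.Im _)).
by apply/andP; split; apply/eqP; lra.
Qed.

Lemma l2_delta (v : I) : l2 (Defs.delta R v).
Proof.
apply: (@sqnorm_finite_l2 _ _ _ 1); apply/sqnorm_leP => t tuniq.
have csq_delta u : csq (Defs.delta R v u) = (u == v)%:R.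
  by rewrite /Defs.delta; case: eqP => _; rewrite /csq/= ?expr1n !expr0n ?addr0.
under eq_bigr do rewrite csq_delta.
have [vt|vt] := boolP (v \in t).
  rewrite (bigD1_seq v)//= eqxx big1 ?addr0// => u /negbTE -> //.
by rewrite big_seq big1// => u ut; case: eqP ut vt => // -> ->.
Qed.

(** Only the positive part matters: the subtracted term is [fine] of a nonnegative sum, hence
    nonnegative even if that sum is infinite. *)
Lemma rsum_le f (s : R) :
  (forall t : seq I, uniq t -> \sum_(u <- t) Num.max (f u) 0 <= s) -> rsum f <= s.
Proof.
move=> /esum_leP fs; rewrite /rsum lerBlDr (@le_trans _ _ s)//.
  rewrite -lee_fin fineK// ge0_fin_numE ?(le_lt_trans fs) ?ltry//.
  by apply: esum_ge0 => u _; rewrite lee_fin le_max lexx orbT.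
by rewrite lerDl fine_ge0// esum_ge0// => u _; rewrite lee_fin le_max lexx orbT.
Qed.

Lemma rsum_supp1 f (v : I) : (forall u, u != v -> f u = 0) -> rsum f = f v.
Proof.
move=> f0.
have esum_supp1 (a : I -> R) : (forall u, 0 <= a u) -> (forall u, u != v -> a u = 0) ->
    (\esum_(u in [set: I]) (a u)%:E = (a v)%:E)%E.
  move=> a_ge0 a0; rewrite -(@esum_set1 _ _ v (fun u => (a u)%:E)) ?lee_fin//.
  rewrite [RHS]esum_mkcond; apply: eq_esum => u _.
  by case: ifPn => //; rewrite notin_setE/= => /eqP /a0 ->.
have max_ge0 (x : R) : 0 <= Num.max x 0 by rewrite le_max lexx orbT.
rewrite /rsum (esum_supp1 (fun u => Num.max (f u) 0)) => [|//|u /f0 ->]; last first.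
  by rewrite maxxx.
rewrite (esum_supp1 (fun u => Num.max (- f u) 0)) => [|//|u /f0 ->]; last first.
  by rewrite oppr0 maxxx.
rewrite /=; case/orP: (le_total 0 (f v)) => fv.
  by rewrite (max_idPl _)// (max_idPr _) ?subr0// oppr_le0.
by rewrite (max_idPr _)// (max_idPl _) ?oppr_ge0// sub0r opprK.
Qed.

Lemma l2dot_delta (v : I) xi : l2dot (Defs.delta R v) xi = xi v.
Proof.
rewrite /l2dot !(@rsum_supp1 _ v); first last.
- by move=> u /negbTE uv; rewrite /Defs.delta uv /= !(mul0r, mulNr, oppr0, subr0, addr0).
- by move=> u /negbTE uv; rewrite /Defs.delta uv /= !(mul0r, mulNr, oppr0, subr0, addr0).
rewrite /Defs.delta eqxx; case: (xi v) => x y /=.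
by rewrite oppr0 !mul0r subr0 addr0 !mul1r.
Qed.

Lemma l2dot_sqnorm eta : complex.Re (l2dot eta eta) = fine (sqnorm eta).
Proof.
have csqRe u : complex.Re ((eta u)^* * eta u) = csq (eta u) by rewrite -csqE.
rewrite /l2dot /rsum /=.
rewrite [X in _ - fine X]esum1 => [|u _]; last first.
  by rewrite csqRe (max_idPr _)// oppr_le0 csq_ge0.
rewrite subr0; congr fine; apply: eq_esum => u _.
by rewrite csqRe (max_idPl _)// csq_ge0.
Qed.

(** The inequality [0 <= |eta - xi|^2], used at each point and then summed. *)
Lemma Re_l2dot_le eta xi (a b : R) :
  (sqnorm eta <= a%:E)%E -> (sqnorm xi <= b%:E)%E ->
  complex.Re (l2dot eta xi) *+ 2 <= a + b.
Proof.
move=> /sqnorm_leP etaa /sqnorm_leP xib.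
suff : complex.Re (l2dot eta xi) <= (a + b) / 2 by rewrite ler_pdivlMr// mulr_natr.
apply: rsum_le => t tuniq; rewrite ler_pdivlMr// mulr_suml.
apply: (le_trans _ (lerD (etaa t tuniq) (xib t tuniq))); rewrite -big_split/=.
apply: ler_sum => u _; case: (eta u) (xi u) => [x y] [x' y']; rewrite /csq/=.
have := sqr_ge0 (x - x'); have := sqr_ge0 (y - y').
have := sqr_ge0 x; have := sqr_ge0 x'; have := sqr_ge0 y; have := sqr_ge0 y'.
rewrite -ler_pdivlMr// ge_max !ler_pdivlMr// mul0r !expr2 => *.
by apply/andP; split; nra.
Qed.

End L2.

(** * The universal cover *)

Section UniversalCover.
Variables (R : realType) (V E : finType) (G : graph R V E) (r : V).
Implicit Types (w : uvertex G r) (e : E).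

Lemma nb_from_rcons (t : seq E) e : nb_from G r (rcons t e) =
  [&& nb_from G r t, src G e == last r (map (tgt G) t) & last e t != rev_edge G e].
Proof.
case: t => [|f t] /=; first by rewrite (eq_sym e) rev_edge_neq.
rewrite rcons_path -andbA; congr (_ && (_ && _)).
by rewrite /nb_step last_map eq_sym.
Qed.

Lemma nb_from_sorted (t : seq E) : nb_from G r t -> sorted (nb_step G) t.
Proof. by case: t => //= e t /andP[]. Qed.

(** The neighbour of [w] in the tree across the lift of [e]. For the empty walk the default of
    [last] is [e], which differs from its reverse, so [e] is pushed. The default of [insubd] is not
    reached when [e] starts at [Xi w]. *)
Definition ustep w e : uvertex G r :=
  insubd w (if last e (val w) == rev_edge G e then take (size (val w)).-1 (val w)
            else rcons (val w) e).

Variant ustep_spec w e : uvertex G r -> Prop :=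
| UstepPush w' of val w' = rcons (val w) e & last e (val w) != rev_edge G e :
    ustep_spec w e w'
| UstepPop w' of val w = rcons (val w') (rev_edge G e) : ustep_spec w e w'.

Lemma ustepP w e : src G e = Xi w -> ustep_spec w e (ustep w e).
Proof.
move=> ew; rewrite /ustep; case: ifPn => [|we].
  have := valP w; case/lastP Dw : (val w) => [|t f].
    by rewrite /= eq_sym (negbTE (rev_edge_neq G e)).
  rewrite nb_from_rcons last_rcons => /and3P[tnb _ _] /eqP fe.
  have -> : take (size (rcons t f)).-1 (rcons t f) = t.
    by rewrite size_rcons -cats1 take_size_cat.
  by apply: UstepPop; rewrite insubdK// -fe.
have wenb : nb_from G r (rcons (val w) e).
  by rewrite nb_from_rcons (valP w) -/(Xi w) ew eqxx.
by apply: UstepPush => //; rewrite insubdK.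
Qed.

Lemma Xi_ustep w e : src G e = Xi w -> Xi (ustep w e) = tgt G e.
Proof.
move=> ew; case: (ustepP ew) => [w' w'E _|w' wE].
  by rewrite /Xi w'E map_rcons last_rcons.
have := valP w; rewrite wE nb_from_rcons => /and3P[_ /eqP + _].
by rewrite -/(Xi w').
Qed.

Lemma ustepK w e : src G e = Xi w -> ustep (ustep w e) (rev_edge G e) = w.
Proof.
move=> ew; have rew : src G (rev_edge G e) = Xi (ustep w e) by rewrite Xi_ustep.
apply/val_inj; move: rew; case: (ustepP ew) => [w' w'E we|w' wE] rew.
  case: (ustepP rew) => [w'' _|w'' ]; rewrite w'E.
    by rewrite last_rcons rev_edgeK eqxx.
  by rewrite rev_edgeK => /rcons_inj[].
case: (ustepP rew) => [w'' -> _|w'' w'E]; first by rewrite wE.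
have := valP w; rewrite wE nb_from_rcons => /and3P[_ _].
by rewrite w'E last_rcons eqxx.
Qed.

(** The covering map is a bijection from the tree edges ending at [w] to the edges of [G] ending at
    [Xi w]. *)
Lemma jacobi_ucoverE (eta : uvertex G r -> R[i]) w :
  jacobi (ucover G r) eta w = (pot G (Xi w))%:C * eta w +
    \sum_(e | tgt G e == Xi w) weight G e * eta (ustep w (rev_edge G e)).
Proof.
rewrite /jacobi; congr (_ + _).
rewrite (@bigfs _ _ _ _ (index_enum E)) ?index_enum_uniq//; last first.
  by move=> e _; rewrite mem_index_enum.
have srcX (x : uedge G r) : tgt (ucover G r) x = w ->
    src G (rev_edge G (Xi_edge x)) = Xi w /\
    usrc x = ustep w (rev_edge G (Xi_edge x)).
  case: x => [[[v e] ve] []]; rewrite /tgt/= /Xi_edge/=.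
    have := ve => /=; rewrite nb_from_rcons/= => /and3P[_ /eqP ev elast] vw.
    have {}vw : v = w := vw; subst w; rewrite rev_edgeK; split=> //.
    case: (ustepP ev) => [w' w'E _|w' vE]; first by apply/val_inj; rewrite w'E.
    by move: elast; rewrite vE last_rcons eqxx.
  have := ve => /=; rewrite nb_from_rcons/= => /and3P[vnb /eqP ev elast] vw.
  have vE : val w = rcons (val v) e by rewrite -vw.
  have ew : src G (rev_edge G e) = Xi w.
    by rewrite -/(tgt G e) /Xi vE map_rcons last_rcons.
  split=> //; case: (ustepP ew) => [w' _|w']; rewrite vE.
    by rewrite last_rcons rev_edgeK eqxx.
  by rewrite rev_edgeK => /rcons_inj[wv]; exact: (val_inj wv).
rewrite (@reindex_fsbig _ _ _ _ _ (@Xi_edge R V E G r) [set x | tgt (ucover G r) x = w]).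
  by apply: eq_fsbigr => x; rewrite inE => /srcX[_ <-].
split.
- by move=> x /srcX[xw _]; apply/eqP; exact: xw.
(* An edge coming from an extension of [w] and one coming from its prefix have different images,
   otherwise the extension would backtrack. *)
- have mixed (v v' : uvertex G r) e e' (ve : nb_from G r (rcons (val v) e)) :
      v = w -> val w = rcons (val v') e' -> rev_edge G e = e' -> False.
    move=> vw wE ee'; move: ve.
    by rewrite vw wE nb_from_rcons last_rcons ee' eqxx !andbF.
  move=> x y; rewrite !inE.
  case: x => [[[v e] ve] b]; case: y => [[[v' e'] ve'] b'].
  rewrite /tgt/= /Xi_edge/=; case: b; case: b' => /= vw vw' ee'.
  + have {}vw : v = w := vw; have {}vw' : v' = w := vw'; subst v v'.
    have {}ee' := inv_inj (rev_edgeK G) ee'; subst e'.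
    by congr (_, _); exact/val_inj.
  + by case: (mixed v v' e e' ve vw _ ee'); rewrite -vw'.
  + by case: (mixed v' v e' e ve' vw' _ (esym ee')); rewrite -vw.
  + have wE : val w = rcons (val v) e by rewrite -vw.
    have : rcons (val v) e = rcons (val v') e' by rewrite -wE -vw'.
    move=> /rcons_inj[/val_inj vv' _]; subst v' e'.
    by congr (_, _); exact/val_inj.
- move=> e /= /eqP ew.
  have [w' w'E _|w' wE] := ustepP (w := w) (e := rev_edge G e) ew.
    have wenb : nb_from G r (rcons (val w) (rev_edge G e)).
      by rewrite -w'E; exact: valP.
    exists (exist _ (w, rev_edge G e) wenb, true) => //.
    by rewrite /Xi_edge /= rev_edgeK.
  have wenb : nb_from G r (rcons (val w') e).
    by have := valP w; rewrite wE rev_edgeK.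
  exists (exist _ (w', e) wenb, false) => //.
  by apply/val_inj; rewrite wE rev_edgeK.
Qed.

Lemma Xi_surj u : connected_graph G -> exists w, Xi w = u.
Proof.
move=> /(_ r u)/connectP[p + ->] {u}.
elim/last_ind: p => [_|p v IH]; first by exists (exist _ [::] isT).
rewrite rcons_path last_rcons => /andP[/IH[w wu]] /existsP[e /andP[/eqP eu /eqP ev]].
by exists (ustep w e); rewrite Xi_ustep// eu wu.
Qed.

End UniversalCover.

(** * Boundedness of the Jacobi operator of the tree *)

Section BoundedJacobi.
Variables (R : realType) (V E : finType) (G : graph R V E) (r : V).

(** For a fixed edge, the move [ustep] is injective on the vertices above its start, by [ustepK]. *)
Lemma sum_ustep_le (eta : uvertex G r -> R[i]) (e : E) (s : R) t :
  (sqnorm eta <= s%:E)%E -> uniq t ->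
  \sum_(w <- t | tgt G e == Xi w) csq (eta (ustep w (rev_edge G e))) <= s.
Proof.
move=> /sqnorm_leP etas tuniq; rewrite -big_filter.
rewrite -(big_map (fun w => ustep w (rev_edge G e)) xpredT (fun w => csq (eta w))).
apply: etas; rewrite map_inj_in_uniq ?filter_uniq// => w1 w2.
rewrite !mem_filter => /andP[/eqP ew1 _] /andP[/eqP ew2 _] eqw.
by rewrite -(ustepK (w := w1) (e := rev_edge G e)) ?eqw ?ustepK.
Qed.

(** Provides the bound that [bc_id] requires. *)
Lemma jacobi_ucover_bounded : exists M : R, opnorm_le (jacobi (ucover G r)) M.
Proof.
pose K1 : R := \sum_v csq (pot G v)%:C; pose K2 : R := \sum_e csq (weight G e).
pose n := size (index_enum E).
(* The outer 2 separates the potential from the edge sum, [2 ^+ n] comes from [csq_sum_le] over the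
   [n] edges, and each edge contributes at most [K2] times the squared norm. *)
pose C : R := 2 * (K1 + 2 ^+ n * (K2 *+ n)).
exists (Num.sqrt C) => eta etal2.
have K1_ge0 : 0 <= K1 by apply: sumr_ge0 => v _; exact: csq_ge0.
have K2_ge0 : 0 <= K2 by apply: sumr_ge0 => v _; exact: csq_ge0.
have C_ge0 : 0 <= C.
  by rewrite mulr_ge0// addr_ge0// mulr_ge0 ?exprn_ge0// mulrn_wge0.
rewrite /l2norm -sqrtrM//; apply: ler_wsqrtr.
set s := fine (sqnorm eta).
have etas : (sqnorm eta <= s%:E)%E by rewrite sqnormK.
suff Aetas : (sqnorm (jacobi (ucover G r) eta) <= (C * s)%:E)%E.
  by rewrite -lee_fin (sqnormK (sqnorm_finite_l2 Aetas)).
apply/sqnorm_leP => t tuniq.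
have csq_le (w : uvertex G r) : csq (jacobi (ucover G r) eta w) <=
    2 * (K1 * csq (eta w) +
      2 ^+ n * (K2 * \sum_(e | tgt G e == Xi w) csq (eta (ustep w (rev_edge G e))))).
  rewrite jacobi_ucoverE (le_trans (csqD_le _ _))// ler_pM2l// lerD//.
    rewrite csqM ler_wpM2r ?csq_ge0// /K1 (bigD1 (Xi w))//= lerDl.
    by apply: sumr_ge0 => v _; exact: csq_ge0.
  rewrite (le_trans (csq_sum_le _ _ _))// ler_pM2l ?exprn_gt0// mulr_sumr.
  apply: ler_sum => e _; rewrite csqM ler_wpM2r ?csq_ge0// /K2 (bigD1 e)//= lerDl.
  by apply: sumr_ge0 => v _; exact: csq_ge0.
rewrite (le_trans (ler_sum _ (fun w _ => csq_le w)))// -mulr_sumr -mulrA ler_pM2l//.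
rewrite big_split/= -!mulr_sumr mulrDl lerD//.
  by rewrite ler_wpM2l//; exact: (proj1 (sqnorm_leP _ _) etas).
rewrite -mulrA ler_pM2l ?exprn_gt0// mulrnAl -mulrnAr ler_wpM2l//.
under eq_bigr do rewrite big_mkcond/=.
rewrite exchange_big/=; under eq_bigr do rewrite -big_mkcond/=.
rewrite (le_trans (ler_sum _ (fun e _ => sum_ustep_le e etas tuniq)))//.
have -> : n = #|E| by rewrite /n -sum1_size sum1_card.
by rewrite sumr_const.
Qed.

End BoundedJacobi.

(** * Eigenfunctions of the tree obtained from finite covers *)

Section Pullback.
Variables (R : realType) (V E : finType) (G : graph R V E) (r : V).
Variables (S : finType) (s : E -> S -> S).
Hypothesis sK : forall e, cancel (s e) (s (rev_edge G e)).

Lemma holonomy_ustep x (w : uvertex G r) e : src G e = Xi w ->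
  holonomy s x (val (ustep w e)) = s e (holonomy s x (val w)).
Proof.
move=> /ustepP; case=> [w' -> _|w' ->]; rewrite -cats1 holonomy_cat//=.
by rewrite -{1}(rev_edgeK G e) sK.
Qed.

(** The map from [w] to [(Xi w, holonomy s x (val w))] is a local isomorphism from the tree to the
    cover, so pulling back commutes with the Jacobi operators. *)
Lemma jacobi_pullback (lam : R) (f : V * S -> R[i]) x (w : uvertex G r) :
  (forall y, jacobi (sheet_cover sK) f y = lam%:C * f y) ->
  jacobi (ucover G r) (fun w => f (Xi w, holonomy s x (val w))) w =
  lam%:C * f (Xi w, holonomy s x (val w)).
Proof.
move=> <-; rewrite jacobi_ucoverE jacobi_coverE; congr (_ + _).
apply: eq_bigr => e /eqP ew.
by rewrite Xi_ustep ?holonomy_ustep// tgt_rev_edge.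
Qed.

End Pullback.

Lemma sum_uniq_le (R : numDomainType) (I : finType) (t : seq I) (a : I -> R) :
  (forall i, 0 <= a i) -> uniq t -> \sum_(i <- t) a i <= \sum_i a i.
Proof.
move=> a0 tuniq; rewrite big_uniq// [leRHS](bigID [in t])/= lerDl.
exact: sumr_ge0.
Qed.

(** These are eigenfunctions on the whole tree, but their norm is controlled only on the ball of
    radius [N], which embeds in the cover. The bound [p u <= 1] gives compactness in the limit. *)
Lemma approximate_eigenfunctions (R : realType) (V E : finType) (G : graph R V E)
    (r : V) (w0 : V -> uvertex G r) (lam : R) (X : {set V}) (N : nat) :
  (forall u, Xi (w0 u) = u) -> calA G lam X ->
  exists (p : V -> R) (F : V -> uvertex G r -> R[i]),
    [/\ forall u w, jacobi (ucover G r) (F u) w = lam%:C * F u w,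
        forall u, F u (w0 u) = (p u)%:C,
        forall u (t : seq (uvertex G r)), uniq t ->
          (forall w, w \in t -> size (val w) <= N)%N ->
          \sum_(w <- t) csq (F u w) <= p u,
        forall u, 0 <= p u <= 1
      & (cc G X - #|boundary G X|)%:R <= \sum_u p u].
Proof.
move=> w0E XA; pose s := @sheet_act R V E G N; pose sK := @sheet_actK R V E G N.
pose S : finType := (bool * {perm N.-bseq E})%type.
have := sheet_cover_mult (sK : forall e, cancel (s e : S -> S) _) XA.
rewrite /spec_mult; set U := passmx.leigenspace _ _ => dimU.
have [p [f [fU fp pf pU]]] := reproducing_kernel U.
have p_ge0 y : 0 <= p y by rewrite -pf; apply: sumr_ge0 => z _; exact: csq_ge0.
(* The square of [p y] is one term of the sum of the [csq (f y z)], which equals [p y]. *)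
have p_le1 y : p y <= 1.
  have [->//|py] := eqVneq (p y) 0.
  have py_gt0 : 0 < p y by rewrite lt_neqAle eq_sym py p_ge0.
  rewrite -(ler_pM2l py_gt0) mulr1 -[leRHS]pf (bigD1 y)//=.
  have -> : p y * p y = csq (f y y) by rewrite fp /csq/= expr2 expr0n addr0.
  by rewrite lerDl; apply: sumr_ge0 => z _; exact: csq_ge0.
pose x0 : S := (false, 1%g).
pose xm u := [arg max_(x > x0) p (u, x)]%O.
have pm u x : p (u, x) <= p (u, xm u).
  by rewrite /xm; case: arg_maxP => // y _; exact.
(* The starting sheet for which [w0 u] lies above the best point [(u, xm u)]. *)
pose x_ u := holonomy s (xm u) (walk_rev G (val (w0 u))).
have x_E u : holonomy s (x_ u) (val (w0 u)) = xm u.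
  have wE : val (w0 u) = walk_rev G (walk_rev G (val (w0 u))).
    by rewrite /walk_rev map_rev revK mapK//; exact: rev_edgeK.
  by rewrite {1}wE holonomy_rev.
exists (fun u => p (u, xm u)).
exists (fun u w => f (u, xm u) (Xi w, holonomy s (x_ u) (val w))); split.
- move=> u w; apply: (jacobi_pullback (sK := sK) (f := f (u, xm u))).
  by apply/mem_eigenspace; exact: fU.
- by move=> u; rewrite w0E x_E fp.
- move=> u t tuniq tN; rewrite -[leRHS]pf.
  rewrite -(big_map (fun w => (Xi w, holonomy s (x_ u) (val w))) xpredT
    (fun z => csq (f (u, xm u) z))).
  apply: sum_uniq_le => [z|]; first exact: csq_ge0.
  rewrite map_inj_in_uniq// => w1 w2 /tN w1N /tN w2N [_ eqh].
  apply/val_inj; move: eqh; apply: holonomy_sheet_inj => //;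
    by apply: nb_from_sorted; exact: valP.
- by move=> u; rewrite p_ge0 p_le1.
(* The trace of the projection is at least [#|S|] times the excess, and at most [#|S|] times the sum
   of the fibrewise maxima. *)
have S_gt0 : (0 : R) < #|S|%:R by rewrite ltr0n; apply/card_gt0P; exists x0.
rewrite -(ler_pM2l S_gt0) -natrM (@le_trans _ _ (\dim U)%:R) ?ler_nat//.
rewrite -pU (eq_bigr (fun z => p (z.1, z.2))) => [|[]//].
rewrite -(pair_bigA _ (fun u x => p (u, x)))/= mulr_sumr.
apply: ler_sum => u _; rewrite (le_trans (ler_sum _ (fun x _ => pm u x)))//.
by rewrite sumr_const mulr_natl.
Qed.

(** * Limits of eigenfunctions *)

Section ComplexLimit.
Variables (R : realType) (U : set_system nat).
Hypothesis UF : ProperFilter U.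

Definition ccvg (z : nat -> R[i]) (l : R[i]) : Prop :=
  (complex.Re (z n) @[n --> U] --> complex.Re l) /\
  (complex.Im (z n) @[n --> U] --> complex.Im l).

Lemma ccvg_cst (l : R[i]) : ccvg (fun=> l) l.
Proof. by split; exact: cvg_cst. Qed.

Lemma ccvgD z z' l l' : ccvg z l -> ccvg z' l' ->
  ccvg (fun n => z n + z' n) (l + l').
Proof.
move=> [zr zi] [z'r z'i]; split.
- rewrite raddfD/= (_ : (fun n => _) = (fun n => complex.Re (z n) + complex.Re (z' n))).
    exact: cvgD zr z'r.
  by apply/funext => n; rewrite raddfD.
- rewrite raddfD/= (_ : (fun n => _) = (fun n => complex.Im (z n) + complex.Im (z' n))).
    exact: cvgD zi z'i.
  by apply/funext => n; rewrite raddfD.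
Qed.

Lemma ccvgMr (c : R[i]) z l : ccvg z l -> ccvg (fun n => c * z n) (c * l).
Proof.
case: c => a b [zr zi]; split.
- rewrite (_ : (fun n => _) = (fun n => a * complex.Re (z n) - b * complex.Im (z n))).
    rewrite (_ : complex.Re _ = a * complex.Re l - b * complex.Im l); last first.
      by case: l {zr zi}.
    by apply: cvgB; apply: cvgM => //; exact: cvg_cst.
  by apply/funext => n; case: (z n).
- rewrite (_ : (fun n => _) = (fun n => a * complex.Im (z n) + b * complex.Re (z n))).
    rewrite (_ : complex.Im _ = a * complex.Im l + b * complex.Re l); last first.
      by case: l {zr zi}.
    by apply: cvgD; apply: cvgM => //; exact: cvg_cst.
  by apply/funext => n; case: (z n).
Qed.

Lemma ccvg_sum (I : Type) (t : seq I) (P : pred I) (z : I -> nat -> R[i]) l :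
  (forall i, P i -> ccvg (z i) (l i)) ->
  ccvg (fun n => \sum_(i <- t | P i) z i n) (\sum_(i <- t | P i) l i).
Proof.
move=> zl; elim: t => [|i t IH].
  by rewrite big_nil; under [X in ccvg X]eq_fun do rewrite big_nil; exact: ccvg_cst.
rewrite big_cons; under [X in ccvg X]eq_fun do rewrite big_cons.
by case: ifP => // Pi; apply: ccvgD => //; exact: zl.
Qed.

Lemma ccvg_unique z l l' : ccvg z l -> ccvg z l' -> l = l'.
Proof.
move=> [zr zi] [z'r z'i]; case: l l' zr zi z'r z'i => [x y] [x' y'] /= zr zi z'r z'i.
have xx' : x = x' by exact: cvg_unique zr z'r.
have yy' : y = y' by exact: cvg_unique zi z'i.
by rewrite xx' yy'.
Qed.

Lemma ccvg_csq z l : ccvg z l -> csq (z n) @[n --> U] --> csq l.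
Proof. by move=> [zr zi]; apply: cvgD; rewrite !expr2; exact: cvgM. Qed.

End ComplexLimit.

(** If [B] belongs to a finer proper filter, the preimage of its complement cannot be in [U], so
    that of [B] is. *)
Lemma ultra_fmap (T T' : Type) (U : set_system T) (f : T -> T') :
  UltraFilter U -> UltraFilter (f @ U).
Proof.
move=> UU; split; first exact: fmap_proper_filter.
move=> W WF sW; apply/seteqP; split=> // B WB.
have [//|UB] := in_ultra_setVsetC (f @^-1` B) UU.
have /sW WB' : (f @ U) (~` B) by [].
by have := filterI WB WB'; rewrite setICr => /(_ _)/filter_ex[].
Qed.

(** Compactness of [[-1, 1]], applied to the image ultrafilter. *)
Lemma ultra_bounded_cvg (R : realType) (U : set_system nat) (a : nat -> R) :
  UltraFilter U -> U [set n | `|a n| <= 1] -> exists l : R, a n @[n --> U] --> l.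
Proof.
move=> UU Ua.
have := @segment_compact R (-1) 1; rewrite compact_ultra => /(_ (a @ U))[].
- exact: ultra_fmap.
- suff : U [set n | a n \in `[-1, 1]%R] by [].
  by apply: filterS Ua => n /=; rewrite in_itv/= -ler_norml.
- by move=> l [_ al]; exists l.
Qed.

Lemma ultra_bounded_ccvg (R : realType) (U : set_system nat) (z : nat -> R[i]) :
  UltraFilter U -> U [set n | csq (z n) <= 1] -> exists l : R[i], ccvg U z l.
Proof.
move=> UU Uz.
have sqr_le1 (x y : R) : x ^+ 2 + y ^+ 2 <= 1 -> `|x| <= 1.
  move=> xy; rewrite -(@ler_pXn2r _ 2)// ?nnegrE// real_normK ?num_real// expr1n.
  by rewrite (le_trans _ xy)// lerDl sqr_ge0.
have [|x zx] := @ultra_bounded_cvg R U (fun n => complex.Re (z n)) UU.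
  by apply: filterS Uz => n /sqr_le1.
have [|y zy] := @ultra_bounded_cvg R U (fun n => complex.Im (z n)) UU.
  by apply: filterS Uz => n; rewrite /= /csq addrC => /sqr_le1.
by exists (x +i* y).
Qed.

(** One ultrafilter finer than [\oo] gives all the limits at once. The eigenvalue equation at a
    vertex has finitely many terms, and the norm bound is tested on finite sets, so both pass to the
    limit. *)
Lemma limit_eigenfunctions (R : realType) (V E : finType) (G : graph R V E)
    (r : V) (w0 : V -> uvertex G r) (lam : R) (X : {set V}) :
  (forall u, Xi (w0 u) = u) -> calA G lam X ->
  exists (p : V -> R) (g : V -> uvertex G r -> R[i]),
    [/\ forall u w, jacobi (ucover G r) (g u) w = lam%:C * g u w,
        forall u, g u (w0 u) = (p u)%:C,
        forall u, (sqnorm (g u) <= (p u)%:E)%E,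
        forall u, 0 <= p u
      & (cc G X - #|boundary G X|)%:R <= \sum_u p u].
Proof.
move=> w0E XA.
have [U [UU sU]] := ultraFilterLemma (eventually_filter).
have UF : ProperFilter U by exact: ultra_proper.
have /choice[p /choice[F H]] :=
  fun N => @approximate_eigenfunctions R V E G r w0 lam X N w0E XA.
have Umem (k : nat) : U [set n | (k <= n)%N].
  by apply: sU; exists k => // n.
have /choice[q pq] : forall u, exists l : R, p n u @[n --> U] --> l.
  move=> u; apply: ultra_bounded_cvg; apply: filterS (Umem 0%N) => n _ /=.
  by have [_ _ _ /(_ u)/andP[p0 p1] _] := H n; rewrite ger0_norm.
have /choice[g0 Fg0] : forall uw : V * uvertex G r, exists l : R[i],
    ccvg U (fun n => F n uw.1 uw.2) l.
  move=> [u w] /=; apply: ultra_bounded_ccvg.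
  (* As soon as [n] reaches the length of [w], the one-point sum at [w] is at most [p n u <= 1]. *)
  apply: filterS (Umem (size (val w))) => n wn /=.
  have [_ _ /(_ u [:: w] isT) Fw /(_ u)/andP[p0 p1] _] := H n.
  rewrite (le_trans _ p1)//; move: Fw; rewrite big_seq1; apply.
  by move=> w'; rewrite inE => /eqP ->.
pose g u w := g0 (u, w).
have Fg u w : ccvg U (fun n => F n u w) (g u w) by exact: (Fg0 (u, w)).
exists q, g; split.
- move=> u w; apply: (@ccvg_unique R U UF (fun n => jacobi (ucover G r) (F n u) w)).
    rewrite jacobi_ucoverE; under [X in ccvg _ X]eq_fun do rewrite jacobi_ucoverE.
    by apply: ccvgD; [exact: ccvgMr|apply: ccvg_sum => e _; exact: ccvgMr].
  under [X in ccvg _ X]eq_fun => n.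
    have [-> _ _ _ _] := H n.
    over.
  exact: ccvgMr.
- move=> u; apply: (@ccvg_unique R U UF (fun n => F n u (w0 u))) => //.
  under [X in ccvg _ X]eq_fun => n.
    have [_ -> _ _ _] := H n.
    over.
  by split => //=; exact: cvg_cst.
- move=> u; apply/sqnorm_leP => t tuniq.
  have tg : \sum_(w <- t) csq (F n u w) @[n --> U] --> \sum_(w <- t) csq (g u w).
    by apply: cvg_big => [|w _]; [exact: add_continuous|exact: ccvg_csq].
  rewrite -subr_ge0; apply: (cvgr_to_ge (cvgB (pq u) tg)).
  (* From this index on, the ball of radius [n] contains all of [t]. *)
  apply: filterS (Umem (\max_(w <- t) size (val w))%N) => n tn /=.
  rewrite subr_ge0.
  have [_ _ + _ _] := H n; apply => // w wt.
  by apply: leq_trans tn; exact: (@leq_bigmax_seq _ t xpredT (fun w => size (val w))).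
- move=> u; apply: (cvgr_to_ge (pq u)).
  by apply: nearW => n; have [_ _ _ /(_ u)/andP[]] := H n.
have pqs : \sum_u p n u @[n --> U] --> \sum_u q u.
  by apply: cvg_big => //; exact: add_continuous.
apply: (cvgr_to_ge pqs).
by apply: nearW => n; have [] := H n.
Qed.

(** * Functional calculus *)

Section FunctionalCalculus.
Variables (R : realType) (I : choiceType).
Variables (A : (I -> R[i]) -> (I -> R[i])).
Variables (Phi : (R -> R) -> (I -> R[i]) -> (I -> R[i])).
Hypothesis PhiA : borel_calculus A Phi.

Definition eq_indic (lam x : R) : R := if x == lam then 1 else 0.

Lemma eq_indic_bounded_measurable lam : bounded_measurable (eq_indic lam).
Proof.
split; last by exists 1 => x; rewrite /eq_indic; case: ifP; rewrite ?normr1 ?normr0.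
apply: measurable_fun_ifT => //.
exact: measurable_fun_eqr.
Qed.

Definition neq_indic (lam x : R) : R := if x == lam then 0 else 1.

Lemma neq_indic_bounded_measurable lam : bounded_measurable (neq_indic lam).
Proof.
split; last by exists 1 => x; rewrite /neq_indic; case: ifP; rewrite ?normr1 ?normr0.
apply: measurable_fun_ifT => //.
exact: measurable_fun_eqr.
Qed.

Lemma cst_bounded_measurable (c : R) : bounded_measurable (fun=> c).
Proof. by split; [exact: measurable_cst|exists `|c|]. Qed.

Lemma opnorm_le_weaken M M' : M <= M' -> opnorm_le A M -> opnorm_le A M'.
Proof.
move=> MM' AM eta etal2; rewrite (le_trans (AM eta etal2))//.
by rewrite ler_wpM2r ?sqrtr_ge0.
Qed.

Lemma calculus_eq0 k h g :
  bounded_measurable k -> bounded_measurable h -> l2 g ->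
  Phi h g = (fun=> 0) -> Phi (fun x => k x * h x) g = (fun=> 0).
Proof.
move=> km hm gl2 hg; rewrite (bc_mul PhiA)// hg.
have [/(_ _ gl2) l20 _ _] := bc_bounded PhiA hm; rewrite hg in l20.
have [_ lin _] := bc_bounded PhiA km.
(* Linearity at two zero functions with scalar -1 gives [Phi k 0 = 0]. *)
have := lin (-1) _ _ l20 l20.
rewrite (_ : (fun _ => _ + _) = (fun=> 0)); last first.
  by apply/funext => u; rewrite mulr0 addr0.
by move=> ->; apply/funext => u; rewrite mulN1r addNr.
Qed.

(* [neq_indic lam] is the pointwise limit of the multiples of [x - lam] by
   truncations of its inverse. *)
Lemma calculus_eigenvector lam g M : opnorm_le A M -> l2 g ->
  A g = (fun u => lam%:C * g u) -> Phi (eq_indic lam) g = g.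
Proof.
move=> AM gl2 Ag.
have one_m := cst_bounded_measurable 1.
have eq_m := eq_indic_bounded_measurable lam.
have neq_m := neq_indic_bounded_measurable lam.
suff neq0 : Phi (neq_indic lam) g = (fun=> 0).
  rewrite -[RHS](bc_one PhiA gl2).
  rewrite (_ : (fun=> 1) = (fun x => eq_indic lam x + neq_indic lam x)); last first.
    by apply/funext => x; rewrite /eq_indic /neq_indic; case: ifP; rewrite ?addr0 ?add0r.
  by rewrite (bc_add PhiA)// neq0; apply/funext => u; rewrite addr0.
(* Staying [n.+1%:R^-1] away from [lam] keeps the inverse bounded. The truncation at [M + n%:R],
   which is at least [M], still represents [A] by [bc_id]. *)
pose d n (x : R) := (n.+1%:R^-1 < `|x - lam|) && (`|x| <= M + n%:R).
pose tr n (x : R) := if `|x| <= M + n%:R then x else 0.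
(* The truncated inverse of [x - lam], in a form that is visibly measurable. *)
pose k n (x : R) := if d n x then (x - lam) * (((x - lam) ^+ 2) `^ (-1)) else 0.
pose e n (x : R) : R := if d n x then 1 else 0.
have norm_m (c : R) : measurable_fun [set: measurableTypeR R] (fun x : R => `|x - c|).
  apply: measurableT_comp => //.
  exact: measurable_funB.
have le_m (c : R) : measurable_fun [set: measurableTypeR R] (fun x : R => `|x| <= c).
  exact: measurable_fun_ler.
have d_m n : measurable_fun [set: measurableTypeR R] (d n).
  by apply: measurable_and => //; apply: measurable_fun_ltr.
have tr_m n : bounded_measurable (tr n).
  split; first by apply: measurable_fun_ifT.
  exists `|M + n%:R| => x; rewrite /tr; case: ifP => [xM|_]; last by rewrite normr0.
  by rewrite (le_trans xM)// ler_norm.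
have kE n x : d n x -> k n x = (x - lam)^-1.
  move=> dx; rewrite /k dx; have /andP[xlam _] := dx.
  have y0 : x - lam != 0 by rewrite -normr_gt0 (le_lt_trans _ xlam)// invr_ge0.
  by rewrite powRN powRr1 ?sqr_ge0// expr2 invfM mulrA mulfV// mul1r.
have k_m n : bounded_measurable (k n).
  split.
    apply: measurable_fun_ifT => //; apply: measurable_funM.
      exact: measurable_funB.
    apply: (measurableT_comp (measurable_powR _)).
    by apply: measurable_funX; exact: measurable_funB.
  exists n.+1%:R => x; have [dx|dx] := boolP (d n x).
    have /andP[xlam _] := dx.
    rewrite kE// normfV -[leRHS]invrK lef_pV2 ?posrE ?invr_gt0// ?ltW//.
    by rewrite (le_lt_trans _ xlam)// invr_ge0.
  by rewrite /k (negbTE dx) normr0.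
have e_m n : bounded_measurable (e n).
  split; first exact: measurable_fun_ifT.
  by exists 1 => x; rewrite /e; case: ifP; rewrite ?normr1 ?normr0.
(* [e n] is [k n] times [x - lam] truncated, and [A - lam] annihilates [g]. *)
have eg n : Phi (e n) g = (fun=> 0).
  rewrite (_ : e n = (fun x => k n x * (tr n x + (- lam) * 1))); last first.
    apply/funext => x; rewrite mulr1; have [dx|dx] := boolP (d n x).
      rewrite kE// /e /tr dx; have /andP[xlam ->] := dx.
      by rewrite mulVf// -normr_gt0 (le_lt_trans _ xlam)// invr_ge0.
    by rewrite /e /k (negbTE dx) mul0r.
  have lam_m : bounded_measurable (fun x : R => - lam * 1).
    exact: cst_bounded_measurable.
  have trlam_m : bounded_measurable (fun x => tr n x + - lam * 1).
    have [t1 [B tB]] := tr_m n; split.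
      exact: measurable_funD.
    exists (B + `|- lam * 1|) => x; rewrite (le_trans (ler_normD _ _))// lerD2r//.
  apply: calculus_eq0 => //.
  rewrite (bc_add PhiA)// (bc_scale PhiA)// (bc_one PhiA)//.
  rewrite (bc_id PhiA (M := M + n%:R))//; last first.
    by apply: opnorm_le_weaken AM; rewrite lerDl.
  by rewrite Ag; apply/funext => u; rewrite rmorphN/= mulNr subrr.
have e_neq x : e n x @[n --> \oo] --> neq_indic lam x.
  rewrite /neq_indic; case: eqP => [->|/eqP xlam].
    rewrite (_ : (fun n => _) = (fun=> 0)); first exact: cvg_cst.
    by apply/funext => n; rewrite /e /d subrr normr0 ltNge invr_ge0 ler0n.
  apply: cvg_near_cst.
  have y_gt0 : 0 < `|x - lam| by rewrite normr_gt0 subr_eq0.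
  near=> n; rewrite /e ifT//; apply/andP; split.
    near: n; exact: (near_infty_natSinv_lt (PosNum y_gt0)).
  rewrite addrC -lerBlDr; near: n; exact: nbhs_infty_ger.
have := bc_continuous PhiA (M := 1) e_m _ e_neq gl2.
have e1 n x : `|e n x| <= 1 by rewrite /e; case: ifP; rewrite ?normr1 ?normr0.
(* All [Phi (e n) g] vanish, so the sequence of norms given by [bc_continuous] is constant, equal to
   the norm of [z], and tends to 0. *)
pose z u := 0 - Phi (neq_indic lam) g u.
move=> /(_ e1); rewrite (_ : (fun n => _) = (fun=> l2norm z)); last first.
  by apply/funext => n; rewrite eg.
move=> cz; have z0 : l2norm z = 0 by exact: cvg_unique (cvg_cst _) cz.
have sqz : sqnorm z = sqnorm (Phi (neq_indic lam) g).
  apply: eq_esum => u _; rewrite /z sub0r.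
  by case: (Phi _ g u) => x y /=; rewrite !sqrrN.
apply/funext => u.
have zl2 : l2 z.
  by rewrite /l2 sqz; have [+ _ _] := bc_bounded PhiA neq_m; apply.
have := l2norm_eq0 zl2 z0 u; rewrite /z sub0r => /eqP.
by rewrite oppr_eq0 => /eqP.
Unshelve. all: by end_near.
Qed.

Lemma calculus_atom_ge lam g M (v : I) (p q : R) :
  opnorm_le A M -> (sqnorm g <= p%:E)%E ->
  A g = (fun u => lam%:C * g u) -> g v = p%:C ->
  l2dot (Defs.delta R v) (Phi (eq_indic lam) (Defs.delta R v)) = q%:C ->
  p <= q.
Proof.
move=> AM gp Ag gv.
have gl2 := sqnorm_finite_l2 gp.
have dl2 := l2_delta R v.
have eq_m := eq_indic_bounded_measurable lam.
set delta := Defs.delta R v in dl2 *; set eta := Phi _ delta => deltaeta.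
have etal2 : l2 eta by have [+ _ _] := bc_bounded PhiA eq_m; apply.
have eq_idem : Phi (eq_indic lam) eta = eta.
  rewrite -(bc_mul PhiA)//; congr (Phi _ delta); apply/funext => x.
  by rewrite /eq_indic; case: ifP; rewrite ?mulr1 ?mulr0.
have etag : l2dot eta g = p%:C.
  by rewrite (bc_selfadjoint PhiA)// (calculus_eigenvector AM gl2 Ag) l2dot_delta.
have etaq : (sqnorm eta <= q%:E)%E.
  (* As the spectral projection is self-adjoint and idempotent, [|eta|^2] is its diagonal entry at
     [v], which is [q]. *)
  rewrite -sqnormK// lee_fin -l2dot_sqnorm {1}/eta (bc_selfadjoint PhiA)//.
  by rewrite eq_idem deltaeta.
have := Re_l2dot_le etaq gp; rewrite etag /=.
by rewrite mulr2n lerD2r.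
Qed.

End FunctionalCalculus.

(* r is the root at which the walks forming the universal cover start *)
Theorem theorem3p3 (R : realType) (V E : finType) (G : graph R V E) (r : V)
    (Gconn : connected_graph G) (lam : R) (X : {set V}) (HX : calA G lam X) :
  (in_spec G lam /\ (cc G X - #|boundary G X| <= spec_mult G lam)%N) /\
  (point_spectrum (ucover G r) lam /\
   forall mu : {measure set (measurableTypeR R) -> \bar R},
     density_of_states G r mu ->
     ((cc G X)%:R - #|boundary G X|%:R)%:E <= #|V|%:R%:E * mu [set lam])%E.
Proof.
have mult := calA_spec_mult HX; have [_ _ bd_lt] := HX.
split.
  split=> //; rewrite /in_spec /passmx.leigenvalue -dimv_eq0 -lt0n.
  by rewrite (leq_trans _ mult)// subn_gt0.
have [w0 w0E] := choice (fun u => @Xi_surj R V E G r u Gconn).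
have [p [g [Ag gp sqg p_ge0 p_sum]]] := limit_eigenfunctions w0E HX.
split.
  (* The sum of the [p u] is positive, and a nonzero [p u] is a nonzero value of [g u]. *)
  have [u pu] : exists u, p u != 0.
    apply: contrapT => /forallNP p0; move: p_sum; rewrite big1 => [|u _].
      by rewrite lern0 subn_eq0 leqNgt bd_lt.
    by apply/eqP/negPn/negP; exact: p0.
  exists (g u); split=> //; first exact: sqnorm_finite_l2 (sqg u).
  by exists (w0 u); rewrite gp; apply: contra pu => /eqP[->].
move=> mu [Phi [mu_ [PhiA mu_E muE]]].
have [M AM] := jacobi_ucover_bounded G r.
have lam_m : measurable ([set lam] : set (measurableTypeR R)) by exact: measurable_set1.
have p_le u : ((p u)%:E <= mu_ u [set lam])%E.
  have [ind_int ind_dot] := mu_E u _ _ (w0E u) (eq_indic_bounded_measurable lam).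
  have indE : (fun x => (eq_indic lam x)%:E) = (fun x => (\1_[set lam] x)%:E :> \bar R).
    apply/funext => x; rewrite indicE /eq_indic.
    by case: eqP => [->|xlam]; [rewrite mem_set|rewrite memNset].
  have intE : (\int[mu_ u]_x (eq_indic lam x)%:E = mu_ u [set lam])%E.
    by rewrite indE integral_indic// setIT.
  (* Integrability of the indicator makes the atom finite, hence a real number to compare with
     [p u]. *)
  have fin : mu_ u [set lam] \is a fin_num.
    by rewrite -intE; exact: integrable_fin_num.
  rewrite -(fineK fin) lee_fin.
  apply: (calculus_atom_ge PhiA AM (sqg u) _ (gp u)).
    by apply/funext => w; exact: Ag.
  by rewrite ind_dot /Rintegral intE.
rewrite muE// muleA -EFinM mulfV ?mul1e; last first.
  by rewrite pnatr_eq0 -lt0n; apply/card_gt0P; exists r.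
apply: (@le_trans _ _ (\sum_u p u)%:E).
  (* Since [#|boundary G X| < cc G X], the truncated subtraction in [p_sum] is exact. *)
  by rewrite lee_fin -natrB// ltnW.
by rewrite -sumEFin; apply: lee_sum.
Qed.
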